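(* Let $f$ be a nonnegative function such that, for some $c>0$, $|f((1+\varepsilon)w)-f(w)|\le c\,\varepsilon f(w)$ for all $w$ and all $\varepsilon\in[0,1/2]$. Let $\widehat{f(\nu_x)}$ be the per-key estimates obtained with a one-pass WORp sample with accuracy parameter $\varepsilon\in(0,\frac13]$, and let $\widehat{f(\nu_x)}'$ be the respective estimates obtained with a (perfect) $p$-ppswor sample. Then for every key $x$, $$\mathrm{Bias}[\widehat{f(\nu_x)}]\le O(\varepsilon)\,f(\nu_x)\qquad\text{and}\qquad \mathrm{MSE}[\widehat{f(\nu_x)}]\le(1+O(\varepsilon))\,\mathrm{Var}[\widehat{f(\nu_x)}']+O(\varepsilon)\,f(\nu_x)^2 .$$
   Context: Let $p\in(0,2]$, let $k\geq 1$, and let $\nu=(\nu_x)$ be a vector of frequencies of keys. Draw i.i.d. $r_x\sim\mathrm{Exp}[1]$ and let $\nu^*_x=\nu_x/r_x^{1/p}$ be the transformed frequencies. For a vector $v$, $v_{(i)}$ denotes its entry of $i$-th largest magnitude. Perfect $p$-ppswor sample of size $k$: the set $S$ of the $k$ keys with largest $|\nu^*_x|$, with threshold $\tau=|\nu^*_{(k+1)}|$. Its per-key estimates are $\widehat{f(\nu_x)}'=0$ for $x\notin S$ and $\widehat{f(\nu_x)}'=\dfrac{f(\nu_x)}{1-\exp(-(|\nu_x|/\tau)^p)}$ for $x\in S$. These are unbiased. One-pass WORp sample with parameter $\varepsilon\in(0,\frac13]$: for some $q\ge p$, a residual heavy hitters sketch of the transformed data gives an estimate $\widehat{\nu^*_x}$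 of $\nu^*_x$ for every key $x$, with the sketch parameters chosen so that its error guarantee $$\|\widehat{\nu^*}-\nu^*\|_\infty\le\varepsilon\,|\nu^*_{(k+1)}|$$ holds; this guarantee is assumed to hold. The sample $S$ consists of the $k$ keys with largest $|\widehat{\nu^*_x}|$. Each $x\in S$ is given the approximate frequency $\nu'_x=\widehat{\nu^*_x}\,r_x^{1/p}$, and the threshold is $|\widehat{\nu^*}_{(k+1)}|$. The per-key estimates are $\widehat{f(\nu_x)}=0$ for $x\notin S$ and, for $x\in S$, $$\widehat{f(\nu_x)}=\frac{f(\nu'_x)}{1-\exp\left(-\left(\frac{|\nu'_x|}{|\widehat{\nu^*}_{(k+1)}|}\right)^p\right)} .$$ $\mathrm{Bias}[\widehat{f(\nu_x)}]=|\mathbb E[\widehat{f(\nu_x)}]-f(\nu_x)|$ and $\mathrm{MSE}[\widehat{f(\nu_x)}]=\mathbb E[(\widehat{f(\nu_x)}-f(\nu_x))^2]$. The constants hidden in $O(\cdot)$ may depend on $c$.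
   Formalization: A key x with frequency 0 is covered only when f(0)=0: if f(0)>0 (e.g. f=1) and at least k+1 frequencies are nonzero, such a key is never sampled, so its bias is f(0), not O(ε)f(0). *)

(* Defs.v *)
From HB Require Import structures.
From mathcomp Require Import all_boot all_order all_algebra.
From mathcomp Require Import all_classical all_reals all_analysis.

Set Implicit Arguments.
Unset Strict Implicit.
Unset Printing Implicit Defensive.

Import Order.TTheory GRing.Theory Num.Theory.
Import numFieldNormedType.Exports.

Local Open Scope classical_set_scope.
Local Open Scope ring_scope.

Section Probability.
Context {d : measure_display} {T : measurableType d} {R : realType}.
Variable P : probability T R.

Definition mutually_independent (K : finType) (X : K -> {RV P >-> R}) : Prop :=
  forall (J : {set K}) (A : K -> set R),
    (forall x, measurable (A x)) ->
    P (\bigcap_(x in [set` J]) (X x @^-1` A x)) =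
    (\prod_(x in J) P (X x @^-1` A x))%E.

Definition iid_exp1 (K : finType) (X : K -> {RV P >-> R}) : Prop :=
  mutually_independent X /\
  forall (x : K) (A : set R), measurable A ->
    distribution P (X x) A = exponential_prob 1 A.

(* These take values in \bar R because the second moments involved can be
   infinite, for instance that of the perfect estimate when k = 1. *)
Definition bias (X : T -> R) (a : R) : \bar R := `|'E_P[X] - a%:E|%E.

Definition mse (X : T -> R) (a : R) : \bar R :=
  ('E_P[(fun w => (X w - a) ^+ 2)%R])%E.

End Probability.

Section Sampling.
Context {R : realType} {K : finType}.

Definition transformed (p : R) (nu r : K -> R) (x : K) : R :=
  nu x / (r x `^ p^-1).

(* |v_(i)|, with i counted from 1; it is 0 when i exceeds the number of keys. *)
Definition order_mag (v : K -> R) (i : nat) : R :=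
  nth 0 (sort >=%R [seq `|v x| | x <- enum K]) i.-1.

(* S consists of k keys of largest magnitude in v (all keys if there are at most
   k of them), ties being broken in any way. *)
Definition is_topk (k : nat) (v : K -> R) (S : {set K}) : Prop :=
  #|S| = minn k #|K| /\
  forall x y, x \in S -> y \notin S -> `|v y| <= `|v x|.

(* The threshold tau = 0 stands for (|v| / tau)^p = +oo, i.e. for certain
   inclusion; the library's v / 0 = 0 would give probability 0 instead. *)
Definition incl_prob (p v tau : R) : R :=
  if tau == 0 then 1 else 1 - expR (- ((`|v| / tau) `^ p)).

Definition key_estimate (p : R) (f : R -> R) (S : {set K}) (freq : K -> R)
    (tau : R) (x : K) : R :=
  if x \in S then f (freq x) / incl_prob p (freq x) tau else 0.

Definition ppswor_estimate (p : R) (k : nat) (f : R -> R) (nu r : K -> R)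
    (S : {set K}) (x : K) : R :=
  key_estimate p f S nu (order_mag (transformed p nu r) k.+1) x.

(* nuhat is the vector of estimates of the transformed frequencies *)
Definition worp_estimate (p : R) (k : nat) (f : R -> R) (nuhat r : K -> R)
    (S : {set K}) (x : K) : R :=
  key_estimate p f S (fun y => nuhat y * r y `^ p^-1) (order_mag nuhat k.+1) x.

End Sampling.

(* A top-k sample as a random set: a measurable selection, possibly with
   randomized tie-breaking. *)
Definition topk_sample {d : measure_display} {T : measurableType d}
    {R : realType} {K : finType} (k : nat) (V : K -> T -> R)
    (S : T -> {set K}) : Prop :=
  (forall w, is_topk k (fun x => V x w) (S w)) /\
  (forall x, measurable [set w | x \in S w]).

(* Main.v *)
(** Fix a key x, let t be the k-th largest transformed magnitude among the other
    keys, and q(s) = 1 - exp(-(|nu_x|/s)^p).  Since t is independent of r_x,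
    P(|nu*_x| >= s | t) = q(s) for every level s determined by t.  On the event
    where the error guarantee holds, the one-pass estimate is squeezed between
    (1 -+ O(eps)) (f(nu_x)/q(t)) times the indicator of |nu*_x| > (1 + 2 eps) t,
    resp. |nu*_x| >= (1 - 2 eps) t: a sampled key has nu'_x = (1 +- O(eps)) nu_x,
    and its empirical threshold is (1 +- O(eps)) t.  As q(s a) and q(s) differ by
    at most the factor a^2 (this uses p <= 2), integrating these bounds gives
    E[est] = (1 +- O(eps)) f(nu_x) and E[est^2] <= (1 + O(eps)) E[f(nu_x)^2/q(t)].
    The perfect sample is the case eps = 0, so its second moment is
    E[f(nu_x)^2/q(t)]; expanding squares yields both claims. *)

Require Import Defs.
From HB Require Import structures.
From mathcomp Require Import all_boot all_order all_algebra.
From mathcomp Require Import all_classical all_reals all_analysis.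
From mathcomp Require Import measurable_realfun lra ring zify.

Set Implicit Arguments.
Unset Strict Implicit.
Unset Printing Implicit Defensive.

Import Order.TTheory GRing.Theory Num.Theory.
Import numFieldNormedType.Exports.

Local Open Scope classical_set_scope.
Local Open Scope ring_scope.

(** * Order statistics and top-k samples *)

(** In a decreasing list the entries above [t] form a prefix. With [0 <= t], the default value 0
    past the end is not above [t] either. *)
Lemma sorted_nth_gt (R : realType) (s : seq R) (t : R) (i : nat) :
  0 <= t -> sorted >=%R s ->
  (t < nth 0 s i) = (i < count (fun z => (t < z)%R) s)%N.
Proof.
move=> t0; elim: s i => [|a s IH] i /=; first by rewrite nth_nil ltNge t0.
move=> hs; have ss := path_sorted hs.
case: (ltP t a) => [ta|at_].
  by case: i => [|i] /=; rewrite ?ta // add1n ltnS IH.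
have alls : all (fun z => (z <= a)%R) s.
  apply: (@order_path_min _ (fun u v : R => (v <= u)%R)) hs => y z u /= yz uy.
  exact: le_trans uy yz.
have -> : count (fun z => t < z) s = 0%N.
  apply/eqP; rewrite -leqn0 leqNgt -has_count; apply/hasPn => z zs.
  by rewrite -leNgt (le_trans _ at_)//; exact: (allP alls).
case: i => [|i] /=; first by rewrite ltNge at_.
rewrite add0n ltn0; apply/negbTE; rewrite -leNgt.
case: (ltnP i (size s)) => his; last by rewrite nth_default.
by rewrite (le_trans _ at_)//; apply: (allP alls); rewrite mem_nth.
Qed.

Section OrderMag.
Context {R : realType} {K : finType}.
Implicit Types (v h : K -> R) (t e : R).

(** Comparisons with an order statistic become counts of keys above a level. Rank [i.+1] is position
    [i] of the sorted list, hence the strict inequality on both sides. *)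
Lemma order_mag_gt v i t : 0 <= t ->
  (t < order_mag v i.+1) = (i < #|[set y | (t < `|v y|)%R]%SET|)%N.
Proof.
move=> t0; rewrite /order_mag sorted_nth_gt//; last first.
  by apply: sort_sorted => x y /=; exact: le_total.
congr (_ < _)%N; rewrite (permP (permEl (perm_sort _ _))) count_map cardE enumT.
by rewrite /enum_mem size_filter; apply: eq_count => y; rewrite /= inE.
Qed.

Lemma order_mag_ge0 v i : 0 <= order_mag v i.
Proof.
rewrite /order_mag; have [ilt|ile] := ltnP i.-1 (size (sort >=%R [seq `|v x| | x <- enum K])).
  have := mem_nth 0 ilt; rewrite mem_sort => /mapP[y _ ->]; exact: normr_ge0.
by rewrite nth_default.
Qed.

Lemma order_mag_le v i (m : R) : 0 <= m ->
  (forall t, 0 <= t -> t < m ->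
     (i < #|[set y | (t < `|v y|)%R]%SET|)%N) -> m <= order_mag v i.+1.
Proof.
move=> m0 H; rewrite leNgt; apply/negP => lt.
have := H _ (order_mag_ge0 v i.+1) lt.
by rewrite -order_mag_gt ?order_mag_ge0// ltxx.
Qed.


(** A key above level [s + e] in [h] is above level [s] in [v], so level sets can be compared by
    inclusion. Exchanging [v] and [h] gives the other direction. *)
Lemma order_mag_perturb v h i e : 0 <= e -> (forall y, `|h y - v y| <= e) ->
  order_mag h i.+1 <= order_mag v i.+1 + e.
Proof.
move=> e0 H; have o0 := order_mag_ge0 v i.+1.
rewrite leNgt; apply/negP; rewrite order_mag_gt ?addr_ge0// => lt.
have := lexx (order_mag v i.+1); rewrite leNgt => /negP; apply.
rewrite order_mag_gt//; apply: (leq_trans lt); apply: subset_leq_card.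
apply/fintype.subsetP => y; rewrite !inE => ly.
by have := H y; have := ler_normB (h y - v y) (- v y); rewrite opprK subrK normrN; lra.
Qed.

(* Zeroing the entry at [x] makes [order_mag (zero_at v x) k] the k-th largest
   magnitude among the keys other than [x]. *)
Definition zero_at v (x : K) : K -> R := fun y => if y == x then 0 else v y.

Lemma zero_at_set v x t : 0 <= t ->
  [set y | (t < `|zero_at v x y|)%R]%SET = ([set y | (t < `|v y|)%R] :\ x)%SET.
Proof.
move=> t0; apply/setP => y; rewrite !inE /zero_at; case: eqVneq => //= _.
by rewrite normr0 ltNge t0.
Qed.

(** Deleting one key removes at most one element from each level set, so the rank drops by at most
    one. *)
Lemma order_mag_le_zero_at v x k :
  order_mag v k.+2 <= order_mag (zero_at v x) k.+1.
Proof.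
apply: order_mag_le; first exact: order_mag_ge0.
move=> t t0; rewrite order_mag_gt// zero_at_set//.
by rewrite (cardsD1 x [set y | _]%SET); case: (x \in _) => /=; lia.
Qed.

(** Here [x] itself lies above every level below [m], so putting it back adds exactly one to the
    count. *)
Lemma order_mag_ge_zero_at v x k m : m <= `|v x| ->
  m <= order_mag (zero_at v x) k.+1 -> m <= order_mag v k.+2.
Proof.
move=> mx mz; have [m0|m0] := leP 0 m; last first.
  by rewrite (le_trans (ltW m0))// order_mag_ge0.
apply: order_mag_le => // t t0 tm.
have := lt_le_trans tm mz; rewrite order_mag_gt// zero_at_set//.
rewrite (cardsD1 x [set y | (t < `|v y|)%R]%SET) inE (lt_le_trans tm mx).
by rewrite add1n ltnS.
Qed.

Lemma topk_threshold k h (S : {set K}) x : is_topk k h S -> x \in S ->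
  order_mag h k.+1 <= `|h x|.
Proof.
move=> [cS HS] xS; rewrite leNgt; apply/negP; rewrite order_mag_gt// => lt.
have : ~~ ([set y | (`|h x| < `|h y|)%R]%SET \subset S).
  by apply/negP => /subset_leq_card; rewrite cS leqNgt (leq_ltn_trans (geq_minl _ _) lt).
move=> /fintype.subsetPn[y]; rewrite inE => hy yS.
by have := HS _ _ xS yS; rewrite leNgt hy.
Qed.

Section Perturbed.
Variables (k : nat) (v h : K -> R) (S : {set K}) (x : K) (d : R).
Hypotheses (d0 : 0 <= d) (vh : forall y, `|h y - v y| <= d) (topS : is_topk k.+1 h S).
(** The sample size is [k.+1]: [t] is the level that [x] has to beat in the exact vector, and
    depends on the other keys only, while [tau] is the exact threshold. *)
Let t := order_mag (zero_at v x) k.+1.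
Let tau := order_mag v k.+2.

(** Besides [x], the sample holds at most [k] keys. If [t] were larger, more than [k] other keys
    would exceed [|h x| + d] in [v]; one of them is unsampled, so its estimate is at most [|h x|], a
    contradiction. *)
Lemma topk_zero_at : x \in S -> t <= `|h x| + d.
Proof.
move=> xS; rewrite leNgt; apply/negP; rewrite order_mag_gt ?addr_ge0// => lt.
case: topS => cS HS.
have : ~~ ([set y | (`|h x| + d < `|zero_at v x y|)%R]%SET \subset S :\ x).
  have Sk : (#|S :\ x| <= k)%N.
    by move: (cardsD1 x S) (geq_minl k.+1 #|K|); rewrite xS -cS add1n => ->.
  by apply/negP => /subset_leq_card; rewrite leqNgt (leq_ltn_trans Sk lt).
move=> /fintype.subsetPn[y]; rewrite !inE /zero_at.
case: eqVneq => /= [_|yx]; first by rewrite normr0 ltNge addr_ge0.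
move=> hy yS; suff : `|v y| <= `|h x| + d by rewrite leNgt hy.
have := HS _ _ xS yS; have := vh y.
have := ler_normB (h y) (h y - v y); rewrite opprB subrKC; lra.
Qed.

Lemma topk_zero_at_le : x \in S -> t <= `|v x| + 2 * d.
Proof.
move=> /topk_zero_at; have := vh x.
by have := ler_normD (h x - v x) (v x); rewrite subrK; lra.
Qed.

(** If [x] beats [t], it raises the rank of [t] by one and [t <= tau]. Otherwise [|v x| <= tau], and
    a sampled [x] is within [2 * d] of [t]. *)
Lemma topk_zero_at_tau : x \in S -> t <= tau + 2 * d.
Proof.
move=> xS; have tz := topk_zero_at_le xS.
have [tx|xt] := leP t `|v x|.
  have H : t <= tau := order_mag_ge_zero_at tx (lexx t).
  by rewrite (le_trans H)// lerDl mulr_ge0.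
have H : `|v x| <= tau := order_mag_ge_zero_at (lexx _) (ltW xt).
by rewrite (le_trans tz)// lerD2r.
Qed.

(** If [x] were left out, all [k.+1] sampled keys would have estimates at least [|h x|], hence true
    magnitudes above [t]; but at most [k] keys other than [x] exceed [t]. *)
Lemma topk_mem : t + 2 * d < `|v x| -> x \in S.
Proof.
move=> tx; apply/negPn/negP => xS; case: topS => cS HS.
(* A sample that misses [x] is not the whole key set, so the minimum in [is_topk] is [k.+1]. *)
have cSk : #|S| = k.+1.
  have : (#|S| < #|K|)%N.
    rewrite -cardsT; apply: proper_card; rewrite properT.
    by apply: contraNneq xS => ->; rewrite inE.
  rewrite cS; case/orP: (leq_total k.+1 #|K|) => [le|le]; first by rewrite (minn_idPl le).
  by rewrite (minn_idPr le) ltnn.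
have := lexx t; rewrite leNgt => /negP; apply.
rewrite {2}/t order_mag_gt ?order_mag_ge0// -cSk; apply: subset_leq_card.
apply/fintype.subsetP => y yS; rewrite inE /zero_at.
case: eqVneq => [yx|_]; first by rewrite yx (negbTE xS) in yS.
have hyx : `|h x| <= `|h y| := HS _ _ yS xS.
have vx : `|v x| <= `|h x| + d.
  by have := vh x; have := ler_normD (h x) (v x - h x); rewrite subrKC distrC; lra.
have hvy : `|h y| <= `|v y| + d.
  by have := vh y; have := ler_normD (v y) (h y - v y); rewrite subrKC; lra.
by have := tx; lra.
Qed.

End Perturbed.

End OrderMag.

(** * Relative Lipschitz functions *)

Section RelativeLipschitz.
Context {R : realType}.
Variable c : R.
Hypothesis c0 : 0 < c.

Let N := (Num.truncn c).+1.

(* Cutting the dilation into [N > c] equal steps keeps the loss of each step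
   below one half, so the bound does not degenerate when [c / 2 >= 1]. *)
Lemma dilation_decrease (f : R -> R) : (forall w, 0 <= f w) ->
  (forall w e : R, 0 <= e <= 2^-1 -> `|f ((1 + e) * w) - f w| <= c * e * f w) ->
  forall w e : R, 0 <= e <= 2^-1 -> f w <= 2 ^+ N * f ((1 + e) * w).
Proof.
move=> f0 fc w e /andP[e0 e2].
have cN : c <= N%:R by exact/ltW/truncnS_gt.
have N0 : 0 < N%:R :> R by rewrite ltr0n.
suff H j : (j <= N)%N -> f w <= 2 ^+ j * f ((1 + j%:R * (e / N%:R)) * w).
  by have := H N (leqnn _); rewrite [N%:R * _]mulrC divfK ?gt_eqF.
have s0 : 0 <= e / N%:R by rewrite divr_ge0// ltW.
elim: j => [_|j IH jN]; first by rewrite expr0 !mul1r mul0r addr0 mul1r.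
apply: (le_trans (IH (ltnW jN))); rewrite exprSr -mulrA ler_wpM2l ?exprn_ge0//.
set a := 1 + j%:R * (e / N%:R).
have a1 : 1 <= a by rewrite lerDl mulr_ge0.
have a0 : 0 < a by exact: lt_le_trans a1.
(* The relative increment that takes the dilation [a] to the next one, [a + e / N]. *)
set e' := e / N%:R / a.
have e'0 : 0 <= e' by rewrite divr_ge0// ltW.
have e'le : e' <= e / N%:R by rewrite ler_pdivrMr// ler_peMr.
have sle : e / N%:R <= e by rewrite ler_pdivrMr// ler_peMr// ler1n.
have ce' : c * e' <= 2^-1.
  apply: (@le_trans _ _ (N%:R * (e / N%:R))); first by rewrite ler_pM// ltW.
  by rewrite mulrCA mulfV ?gt_eqF// mulr1.
have -> : (1 + j.+1%:R * (e / N%:R)) * w = (1 + e') * (a * w).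
  rewrite [RHS]mulrA; congr (_ * _); rewrite [RHS]mulrDl /e' mulfVK ?gt_eqF// mul1r /a.
  by rewrite -addn1 natrD mulrDl mul1r addrA.
have := fc (a * w) e'; rewrite e'0 (le_trans e'le (le_trans sle e2)) => /(_ isT).
rewrite ler_distl => /andP[H _].
have fa := f0 (a * w).
have : c * e' * f (a * w) <= 2^-1 * f (a * w) by rewrite ler_wpM2r.
by move: H; set z := c * e' * _; lra.
Qed.

(** A value dominating what the three ranges of [rho] require below: [3/2 * c * 2 ^+ N] for
    [rho < 1], [c] up to [3/2], and [5/3 * c + 1/3 * c ^+ 2] up to 2. *)
Definition dilation_constant : R := c * (3 + 2 * 2 ^+ N) + c ^+ 2.

(** A contraction is the dilation by [rho^-1] read from the base point [rho * w], after which
    [dilation_decrease] trades [f (rho * w)] for [f w]. Beyond [3/2] the bound is chained through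
    [3/2 * w]. *)
Lemma dilation_lipschitz (f : R -> R) : (forall w, 0 <= f w) ->
  (forall w e : R, 0 <= e <= 2^-1 -> `|f ((1 + e) * w) - f w| <= c * e * f w) ->
  forall w rho : R, 2/3 <= rho <= 2 ->
    `|f (rho * w) - f w| <= dilation_constant * `|rho - 1| * f w.
Proof.
move=> f0 fc w rho /andP[r1 r2]; rewrite /dilation_constant.
set G := 2 ^+ N; have G1 : 1 <= G by rewrite exprn_ege1// ler1n.
have fw := f0 w; have c20 : 0 <= c ^+ 2 by exact: sqr_ge0.
have cG : 0 <= c * G by rewrite mulr_ge0 ?ltW// (lt_le_trans _ G1).
have D0 : 0 <= c * (3 + 2 * G) + c ^+ 2 by have := c0; lra.
have [rho1|rho1] := leP 1 rho; last first.
  have rho0 : 0 < rho by lra.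
  have e0 : 0 <= rho^-1 - 1 by rewrite subr_ge0 invf_ge1// ltW.
  have e2 : rho^-1 - 1 <= 2^-1.
    have -> : 2^-1 = (2/3)^-1 - 1 :> R by field.
    by rewrite lerD2r lef_pV2 ?posrE//; lra.
  have wE : (1 + (rho^-1 - 1)) * (rho * w) = w.
    by rewrite addrC subrK mulrA mulVf ?mul1r// gt_eqF.
  have := fc (rho * w) _ (introT andP (conj e0 e2)).
  have := dilation_decrease f0 fc (rho * w) (introT andP (conj e0 e2)).
  rewrite wE distrC -/G => fG /le_trans; apply.
  have -> : `|rho - 1| = 1 - rho by rewrite distrC ger0_norm ?subr_ge0 ?ltW.
  have -> : rho^-1 - 1 = rho^-1 * (1 - rho) by rewrite mulrBr mulr1 mulVf ?gt_eqF.
  have ri : rho^-1 <= 3/2 by lra.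
  have ri0 : 0 <= rho^-1 by rewrite invr_ge0 ltW.
  apply: (@le_trans _ _ (c * (3/2 * (1 - rho)) * (G * f w))).
    apply: ler_pM => //; first by rewrite !mulr_ge0 ?subr_ge0// ltW.
    by rewrite ler_wpM2l ?ler_wpM2r ?subr_ge0// ltW.
  have -> : c * (3/2 * (1 - rho)) * (G * f w) = (3/2 * (c * G)) * ((1 - rho) * f w).
    by ring.
  rewrite -[leRHS]mulrA; apply: ler_wpM2r; first by rewrite mulr_ge0// subr_ge0 ltW.
  by have := c0; lra.
have -> : `|rho - 1| = rho - 1 by rewrite ger0_norm ?subr_ge0.
have [rho32|rho32] := leP rho (3/2).
  have := fc w (rho - 1); rewrite subrKC => H.
  apply: (le_trans (H _)); first by lra.
  rewrite ler_wpM2r// ler_wpM2r//; first by lra.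
  by have := c0; lra.
have h1 : `|f (3/2 * w) - f w| <= c * 2^-1 * f w.
  have -> : 3/2 = 1 + 2^-1 :> R by lra.
  by apply: fc; lra.
have h2' : 0 <= 2/3 * rho - 1 <= 2^-1 by lra.
have := fc (3/2 * w) _ h2'; rewrite subrKC.
have -> : 2/3 * rho * (3/2 * w) = rho * w by field.
move=> h2; have := ler_distD (f (3/2 * w)) (f (rho * w)) (f w).
move=> /le_trans; apply.
have f32 : f (3/2 * w) <= f w + c * 2^-1 * f w.
  by move: h1; rewrite ler_distl => /andP[_]; lra.
have f320 := f0 (3/2 * w).
apply: (le_trans (lerD h2 h1)).
apply: (@le_trans _ _ (c * (1/3) * (f w + c * 2^-1 * f w) + c * 2^-1 * f w)).
  rewrite lerD2r; apply: ler_pM => //; first by rewrite mulr_ge0 ?ltW//; lra.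
  by rewrite ler_wpM2l ?(ltW c0)//; lra.
have -> : c * (1 / 3) * (f w + c * 2^-1 * f w) + c / 2 * f w =
  (c * (5/6) + c ^+ 2 * (1/6)) * f w by field.
rewrite ler_wpM2r//.
apply: (@le_trans _ _ ((c * (3 + 2 * G) + c ^+ 2) * (1/2))); first by have := c0; lra.
by rewrite ler_wpM2l//; lra.
Qed.

End RelativeLipschitz.

(** * Measurability of functions continuous away from zero *)

Lemma continuous_neq0_measurable (R : realType) (f : R -> R) :
  {in ~` [set 0], continuous f} -> measurable_fun setT f.
Proof.
move=> cont.
have m0 : measurable [set 0 : R] by exact: measurable_set1.
rewrite -(setUv [set 0]); apply/(measurable_funU _ m0 (measurableC m0)); split.
  exact: measurable_fun_set1.
apply: open_continuous_measurable_fun => //.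
by apply: closed_openC; apply/accessible_closed_set1/hausdorff_accessible/norm_hausdorff.
Qed.

Lemma invr_measurable (R : realType) : measurable_fun setT (@GRing.inv R).
Proof.
apply: continuous_neq0_measurable => x; rewrite inE /= => /eqP x0.
exact: inv_continuous.
Qed.

(** Writing [y = (y / w) * w] with [y / w] tending to 1, the relative bound yields continuity of [f]
    at every [w != 0]. *)
Lemma dilation_lipschitz_measurable (R : realType) (D : R) (f : R -> R) :
  (forall w rho : R, 2/3 <= rho <= 2 -> `|f (rho * w) - f w| <= D * `|rho - 1| * f w) ->
  measurable_fun setT f.
Proof.
move=> fD.
have cont : {in ~` [set 0], continuous f}.
  move=> w; rewrite inE /= => /eqP w0.
  apply/cvgrPdist_le => e e0.
  have pos : 0 < `|w| by rewrite normr_gt0.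
  (* The summand 1 keeps the divisor positive when [f w] or [D] vanishes. *)
  pose C := `|D| * `|f w| + 1.
  have C0 : 0 < C by rewrite ltr_wpDl ?mulr_ge0.
  near=> y.
  have yw : `|w - y| <= `|w| * (1/3) by near: y; apply: cvgr_dist_le => //; rewrite mulr_gt0.
  have ye : `|w - y| <= `|w| * (e / C).
    by near: y; apply: cvgr_dist_le => //; rewrite mulr_gt0 ?divr_gt0.
  have E : `|y / w - 1| = `|w - y| / `|w|.
    by rewrite -[1](mulfV w0) -mulrBl normrM normfV distrC.
  have le13 : `|y / w - 1| <= 1/3 by rewrite E ler_pdivrMr// mulrC.
  have leC : `|y / w - 1| <= e / C by rewrite E ler_pdivrMr// mulrC.
  have rho : 2/3 <= y / w <= 2.
    by move: le13; rewrite ler_norml => /andP[? ?]; apply/andP; split; lra.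
  have := fD w _ rho; rewrite divfK// distrC => /le_trans; apply.
  apply: (@le_trans _ _ (`|y / w - 1| * C)).
    rewrite mulrAC mulrC ler_wpM2l//; apply: (@le_trans _ _ (`|D| * `|f w|)).
      by rewrite -normrM ler_norm.
    by rewrite lerDl.
  by rewrite -ler_pdivlMr.
exact: continuous_neq0_measurable.
Unshelve. all: by end_near. Qed.

(** * Inclusion probabilities under scaling *)

Section InclProb.
Context {R : realType}.
Variable p : R.
Hypothesis p02 : 0 < p <= 2.
Let p0 : 0 < p. Proof. by case/andP: p02. Qed.

Lemma incl_prob_ge0 (v tau : R) : 0 <= incl_prob p v tau.
Proof.
rewrite /incl_prob; case: ifPn => // _.
by rewrite subr_ge0 expR_le1 oppr_le0 powR_ge0.
Qed.

Lemma incl_prob_le1 (v tau : R) : incl_prob p v tau <= 1.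
Proof.
by rewrite /incl_prob; case: ifPn => // _; rewrite lerBlDr lerDl expR_ge0.
Qed.

Lemma incl_prob_gt0 (v tau : R) : v != 0 -> 0 <= tau -> 0 < incl_prob p v tau.
Proof.
move=> v0 tau0; rewrite /incl_prob; case: ifPn => // tau_neq0.
rewrite subr_gt0 expR_lt1 oppr_lt0 powR_gt0// divr_gt0 ?normr_gt0//.
by rewrite lt_def tau_neq0.
Qed.

(** This is concavity of [1 - exp(-u)] together with its vanishing at 0; the proof uses
    [1 + y <= exp y] twice. *)
Lemma oneB_expR_scale (s u : R) : 1 <= s -> 0 <= u ->
  1 - expR (- (s * u)) <= s * (1 - expR (- u)).
Proof.
move=> s1 u0.
have -> : - (s * u) = - u + - ((s - 1) * u) by ring.
rewrite expRD; have := expR_ge1Dx (- ((s - 1) * u)) => h1.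
have e0 := expR_ge0 (- u).
have h2 : (1 + u) * expR (- u) <= 1.
  by rewrite expRN ler_pdivrMr ?expR_gt0// mul1r expR_ge1Dx.
have h3 := ler_wpM2l e0 h1.
have h4 : (s - 1) * ((1 + u) * expR (- u)) <= (s - 1) * 1 by rewrite ler_wpM2l ?subr_ge0.
by move: h3 h4; lra.
Qed.

(** The comparison of [|v'| / tau'] with [|v| / tau] is cross-multiplied so that it covers zero
    thresholds, where the probability is 1 by convention. The factor [a ^+ 2] bounds [a ^ p], as
    [p <= 2]. *)
Lemma incl_prob_scale (v v' tau tau' a : R) : 0 <= tau -> 0 <= tau' ->
  (tau' = 0 -> tau = 0) -> 1 <= a -> `|v'| * tau <= a * (`|v| * tau') ->
  incl_prob p v' tau' <= a ^+ 2 * incl_prob p v tau.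
Proof.
move=> t0 t'0 tt' a1 H; rewrite {2}/incl_prob.
have a0 : 0 <= a by exact: le_trans a1.
case: ifPn => [_|tn0].
  by rewrite mulr1 (le_trans (incl_prob_le1 _ _))// exprn_ege1.
have t'n0 : tau' != 0 by apply: contra_neq tn0.
have tp : 0 < tau by rewrite lt_def tn0.
have t'p : 0 < tau' by rewrite lt_def t'n0.
rewrite /incl_prob (negbTE t'n0).
set z : R := `|v| / tau; have z0 : 0 <= z by rewrite divr_ge0.
have le1 : `|v'| / tau' <= a * z.
  by rewrite ler_pdivrMr// /z mulrA mulrAC ler_pdivlMr// -mulrA.
have le2 : (`|v'| / tau') `^ p <= a ^+ 2 * z `^ p.
  apply: (@le_trans _ _ ((a * z) `^ p)).
    have p0' := ltW p0.
    have q0 : 0 <= `|v'| / tau' by exact: divr_ge0.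
    have az0 : 0 <= a * z by exact: mulr_ge0.
    exact: ge0_ler_powR.
  rewrite powRM// ler_wpM2r ?powR_ge0// -powR_mulrn//; apply: ler_powR => //.
  by case/andP: p02.
apply: (@le_trans _ _ (1 - expR (- (a ^+ 2 * z `^ p)))).
  by rewrite lerD2l lerN2 ler_expR lerN2.
by apply: oneB_expR_scale; rewrite ?powR_ge0// exprn_ege1.
Qed.

Lemma measurable_incl_prob d (T : measurableType d) (v tau : T -> R) :
  measurable_fun setT v -> measurable_fun setT tau ->
  measurable_fun setT (fun w => incl_prob p (v w) (tau w)).
Proof.
move=> mv mt; rewrite /incl_prob; apply: measurable_fun_ifT => //.
  exact: measurable_fun_eqr.
apply: measurable_funB => //; apply: measurableT_comp => //.
apply: measurable_funN; apply: (measurableT_comp (measurable_powR p)).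
apply: measurable_funM; first exact: measurableT_comp.
exact: measurableT_comp (@invr_measurable _) mt.
Qed.

End InclProb.

(** * Independence of a frequency and the threshold of the other keys *)

Section CountEvents.
Context {d : measure_display} {T : measurableType d} {R : realType} {K : finType}.
Implicit Types (V : K -> T -> R).

Lemma measurable_eq_finset (U : K -> set T) (J : {set K}) :
  (forall y, measurable (U y)) ->
  measurable [set w | [set y | `[< U y w >]]%SET = J].
Proof.
move=> mU.
rewrite [X in measurable X](_ : _ =
    \bigcap_(y in [set: K]) (if y \in J then U y else ~` U y)); last first.
  apply/seteqP; split => [w /= <- y _ /=|w /= H].
    by rewrite inE; case: asboolP.
  apply/setP => y; rewrite inE; have := H y I; rewrite /=.
  by case: ifPn => _ ?; [apply/asboolP|apply/asboolPn].
apply: fin_bigcap_measurable => //= y _.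
by case: ifPn => _ //; exact: measurableC.
Qed.

(** Rays generate the Borel sets, and a ray event is a finite union over the possible sets [J] of
    keys above the level. *)
Lemma measurable_order_mag V i : (forall y, measurable_fun setT (V y)) ->
  measurable_fun setT (fun w => order_mag (V ^~ w) i.+1).
Proof.
move=> mV; apply: (measurability _ (RGenOInfty.measurableE R)) => _ [_ [t ->] <-].
rewrite setTI; have [t0|t0] := leP 0 t; last first.
  rewrite [X in measurable X](_ : _ = setT)//; apply/seteqP; split => // w _ /=.
  by rewrite in_itv/= andbT (lt_le_trans t0)// order_mag_ge0.
pose U y : set T := [set w | (t < `|V y w|)%R].
have mU y : measurable (U y).
  have := @measurable_fun_ltr _ _ _ setT (cst t) (fun w => `|V y w|).
  move=> /(_ (measurable_cst _) (measurableT_comp (@normr_measurable _ _) (mV y))).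
  by move=> /(_ measurableT [set true] I); rewrite setTI.
rewrite [X in measurable X](_ : _ = \bigcup_(J in [set J : {set K} | (i < #|J|)%N])
    [set w | [set y | `[< U y w >]]%SET = J]).
  by apply: fin_bigcup_measurable => // J _; exact: measurable_eq_finset.
have E w : [set y | `[< U y w >]]%SET = [set y | (t < `|V y w|)%R]%SET.
  by apply/setP => y; rewrite !inE /U /= asboolb.
apply/seteqP; split => [w /=|w [J /= iJ EJ]].
  rewrite in_itv/= andbT order_mag_gt// => H.
  by exists [set y | (t < `|V y w|)%R]%SET; [exact: H|exact: E].
by move: iJ; rewrite -EJ E => iJ; rewrite /= in_itv/= andbT order_mag_gt.
Qed.

End CountEvents.

Section Independence.
Context {d : measure_display} {T : measurableType d} {R : realType}.
Variable P : probability T R.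

(** Independence makes the joint law the product law; Tonelli then integrates [X] out first. *)
Lemma independent_integral (X Y : {RV P >-> R}) :
  (forall A B, measurable A -> measurable B ->
    P (X @^-1` A `&` Y @^-1` B) = (P (X @^-1` A) * P (Y @^-1` B))%E) ->
  forall h : R * R -> \bar R, measurable_fun setT h -> (forall z, (0 <= h z)%E) ->
  (\int[P]_w h (X w, Y w) = \int[P]_w \int[distribution P X]_s h (s, Y w))%E.
Proof.
move=> XY h mh h0.
have mXY : measurable_fun setT (fun w => (X w, Y w)).
  by apply/measurable_fun_pairP; split; exact: measurable_funPT.
pose mXY' := isMeasurableFun.Build _ _ _ _ _ mXY.
pose Z : {mfun T >-> (R * R)%type} := HB.pack (fun w => (X w, Y w)) mXY'.
transitivity (\int[distribution P Z]_z h z)%E.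
  by rewrite (ge0_integral_distribution (Z : {RV P >-> (R * R)%type})).
rewrite (eq_measure_integral (distribution P X \x distribution P Y)%E); last first.
  by move=> A mA _; apply/esym; apply: product_measure_unique.
rewrite fubini_tonelli1// fubini_tonelli//.
rewrite (ge0_integral_distribution Y)//.
  exact: measurable_fun_fubini_tonelli_G.
by move=> y; apply: integral_ge0.
Qed.

(** Mutual independence speaks of one event per key, so each ray event of [tau] is cut into disjoint
    pieces that prescribe which other keys exceed the level. Uniqueness of measures passes from rays
    to Borel sets. *)
Lemma order_mag_independent (K : finType) (r : K -> {RV P >-> R}) (g : K -> R -> R)
    (x : K) (k : nat) :
  mutually_independent r -> (forall y, measurable_fun setT (g y)) ->
  let tau w := order_mag (zero_at (fun y => g y (r y w)) x) k.+1 in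
  forall A B, measurable A -> measurable B ->
    P (r x @^-1` A `&` tau @^-1` B) = (P (r x @^-1` A) * P (tau @^-1` B))%E.
Proof.
move=> indep mg tau A B mA mB.
have mt : measurable_fun setT tau.
  apply: (@measurable_order_mag _ _ _ _ (fun y w => zero_at (fun y => g y (r y w)) x y)) => y.
  rewrite /zero_at; case: (y == x) => //.
  exact: measurableT_comp (mg y) (measurable_funPT (r y)).
have mF : measurable (r x @^-1` A) by exact: measurable_funPTI.
have F0 : 0 <= fine (P (r x @^-1` A)) by apply/fine_ge0/measure_ge0.
pose PF : {nonneg R} := NngNum F0.
have PFE : (PF%:num%:E = P (r x @^-1` A))%E by rewrite /= fineK// fin_num_measure.
(* Both sides, as functions of [B], are pushforwards along [tau]: of [P] restricted to the event on
   [r x], and of [P] scaled by its probability. *)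
pose m1 : {measure set T -> \bar R} := mrestr P mF.
pose m2 : {measure set T -> \bar R} := mscale PF P.
pose mt' := isMeasurableFun.Build _ _ _ _ _ mt.
pose Y : {mfun T >-> R} := HB.pack tau mt'.
suff : pushforward m1 Y B = pushforward m2 Y B.
  by move=> H; rewrite setIC -PFE; exact: H.
apply: (measure_unique (@RGenOInfty.G R) (fun n => `]- n%:R, +oo[%classic)) => //.
- exact: RGenOInfty.measurableE.
- move=> _ _ [a ->] [b ->]; exists (Num.max a b).
  by apply/seteqP; split => z /=; rewrite !in_itv/= !andbT gt_max => /andP.
- by move=> n; exists (- n%:R).
- apply/seteqP; split => // z _; exists (Num.truncn `|z|).+1 => //=.
  rewrite in_itv/= andbT ltrNl (le_lt_trans (ler_norm _))// normrN.
  exact: truncnS_gt.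
- move=> _ [t ->]; change (m1 (tau @^-1` `]t, +oo[) = m2 (tau @^-1` `]t, +oo[)).
  (* A ray from a negative level carries the whole space, since order statistics are nonnegative. *)
  have [t0|t0] := leP 0 t; last first.
    have -> : tau @^-1` `]t, +oo[ = setT.
      apply/seteqP; split => // w _ /=.
      by rewrite in_itv/= andbT (lt_le_trans t0)// order_mag_ge0.
    change (P (setT `&` r x @^-1` A) = (PF%:num)%:E * P setT)%E.
    by rewrite setTI probability_setT mule1 PFE.
  pose U y : set R := [set s | (t < `|g y s|)%R].
  have mU y : measurable (U y).
    have := @measurable_fun_ltr _ _ _ setT (cst t) (fun s => `|g y s|).
    move=> /(_ (measurable_cst _) (measurableT_comp (@normr_measurable _ _) (mg y))).
    move=> /(_ measurableT [set true] I); by rewrite setTI.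
  pose C (J : {set K}) y : set R := if y \in J then U y else ~` U y.
  have mC J y : measurable (C J y).
    by rewrite /C; case: ifPn => // _; exact: measurableC.
  (* [E J] says that [J] is exactly the set of other keys above [t]. Taking it empty when [x \in J]
     keeps the family disjoint. *)
  pose E (J : {set K}) : set T := if x \in J then set0 else
    \bigcap_(y in [set` [set~ x]%SET]) (r y @^-1` C J y).
  have mE J : measurable (E J).
    rewrite /E; case: ifPn => // _; apply: fin_bigcap_measurable => // y _.
    exact: measurable_funPTI.
  have mEw J w : E J w -> J = ([set y | (t < `|g y (r y w)|)%R] :\ x)%SET.
    rewrite /E; case: ifPn => // xJ H; apply/setP => y; rewrite !inE.
    have [->|yx] := eqVneq y x; first exact/negbTE.
    have := H y; rewrite /= !inE yx => /(_ isT); rewrite /C.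
    by case: ifPn => _ /=; rewrite /U /=; [move=> ->|move=> /negP/negbTE ->].
  have Ew w : E ([set y | (t < `|g y (r y w)|)%R] :\ x)%SET w.
    rewrite /E !inE eqxx /= => y; rewrite /= !inE => yx; rewrite /C !inE yx /=.
    by case: ifPn => [//|/negP].
  have -> : tau @^-1` `]t, +oo[ = \bigcup_(J in [set J : {set K} | (k < #|J|)%N]) E J.
    apply/seteqP; split => w /=.
      rewrite in_itv/= andbT /tau order_mag_gt// zero_at_set// => H.
      by exists ([set y | (t < `|g y (r y w)|)%R] :\ x)%SET.
    move=> [J /= kJ /mEw EJ]; rewrite in_itv/= andbT /tau order_mag_gt//.
    by rewrite zero_at_set// -EJ.
  have tE : trivIset [set J : {set K} | (k < #|J|)%N] E.
    by move=> J J' _ _ [w [/mEw -> /mEw ->]].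
  rewrite !measure_fin_bigcup//; [|exact: finite_finset..].
  apply: (@eq_fsbigr _ _ _ _ (fun J => m1 (E J)) (fun J => m2 (E J))) => J _.
  change (P (E J `&` r x @^-1` A) = (PF%:num)%:E * P (E J))%E.
  rewrite PFE /E; case: ifPn => xJ.
    by rewrite set0I !measure0 mule0.
  rewrite (indep [set~ x]%SET (C J))//.
  (* Independence is used twice, for the other keys alone and for all keys with [A] at [x]; the two
     products differ by the factor at [x]. *)
  have := indep [set: K]%SET (fun y => if y == x then A else C J y).
  rewrite (bigD1 x) ?inE//= eqxx => indepT.
  transitivity (P (\bigcap_(y in [set` [set: K]%SET])
      (r y @^-1` (if y == x then A else C J y)))).
    congr (P _); apply/seteqP; split => w /=.
      move=> [H Aw] y _; case: eqVneq => [->//|yx].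
      by apply: H; rewrite /= !inE.
    move=> H; split; last by have := H x; rewrite eqxx /= inE; apply.
    move=> y; rewrite /= !inE => yx; have := H y.
    by rewrite (negbTE yx) /= inE; apply.
  rewrite indepT; last by move=> y; case: ifPn.
  congr (_ * _)%E; apply: eq_big => [y|y]; first by rewrite !inE.
  by rewrite inE/= => /negbTE ->.
- move=> n; change (P (tau @^-1` `](- n%:R)%R, +oo[ `&` r x @^-1` A) < +oo)%E.
  rewrite (le_lt_trans (probability_le1 P _)) ?ltry//.
  by apply: measurableI => //; exact: (measurable_funPTI Y).
Qed.

End Independence.

(** * Law of a transformed frequency *)

Lemma measure_eq_null d (T : measurableType d) (R : realType)
    (mu : {measure set T -> \bar R}) (A B N : set T) :
  measurable A -> measurable B -> measurable N -> mu N = 0%E ->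
  A `<=` B `|` N -> B `<=` A `|` N -> mu A = mu B.
Proof.
move=> mA mB mN N0 AB BA; apply/eqP; rewrite eq_le; apply/andP; split.
  rewrite -(measureU0 mB mN N0); apply: le_measure => //; rewrite inE//.
  exact: measurableU.
rewrite -(measureU0 mA mN N0); apply: le_measure => //; rewrite inE//.
exact: measurableU.
Qed.

Section ExponentialLaw.
Context {R : realType}.
Variable mu : probability R R.
Hypothesis muE : forall A, measurable A -> mu A = exponential_prob 1 A.

Lemma exponential_set1 a : mu [set a] = 0%E.
Proof.
by rewrite muE; [rewrite /exponential_prob integral_set1|exact: measurable_set1].
Qed.

Lemma exponential_le0 : mu `]-oo, 0]%classic = 0%E.
Proof.
have m0 : mu `]-oo, 0[%classic = 0%E.
  rewrite muE//; apply: integral0_eq => s /=; rewrite in_itv/= => s0.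
  rewrite /exponential_pdf patchE ifF//; apply/negbTE.
  by rewrite notin_setE /= in_itv/= andbT; apply/negP; rewrite -ltNge.
rewrite (@measure_eq_null _ _ _ mu _ `]-oo, 0[%classic [set 0])//.
- exact: exponential_set1.
- by move=> s /=; rewrite !in_itv/= le_eqVlt => /orP[/eqP|]; [right|left].
- by move=> s /=; rewrite !in_itv/= => /ltW; left.
Qed.

(** The condition [u <= |v| / s ^ (1/p)] means [s <= (|v| / u) ^ p], so the exponential distribution
    function gives the answer. Sandwiching [A] treats strict and weak comparison at once: they
    differ by a null set. *)
Lemma exponential_law (p v u : R) (A : set R) : 0 < p -> v != 0 -> 0 <= u ->
  measurable A ->
  (forall s : R, u < `|v / s `^ p^-1| -> A s) ->
  (forall s : R, A s -> u <= `|v / s `^ p^-1|) ->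
  mu A = (incl_prob p v u)%:E.
Proof.
move=> p0 v0 u0 mA Alt Ale; rewrite /incl_prob.
have vp : 0 < `|v| by rewrite normr_gt0.
have nE s : 0 < s -> `|v / s `^ p^-1| = `|v| / s `^ p^-1.
  by move=> s0; rewrite normrM normfV (ger0_norm (powR_ge0 _ _)).
(* At level 0 every [s > 0] qualifies, in agreement with the convention of [incl_prob]. *)
have [uE|un0] := eqVneq u 0.
  rewrite (@measure_eq_null _ _ _ mu _ setT `]-oo, 0]%classic)//.
  - exact: probability_setT.
  - exact: exponential_le0.
  - by move=> s _; left.
  - move=> s _; have [s0|s0] := ltP 0 s; last by right; rewrite /= in_itv.
    by left; apply: Alt; rewrite nE// uE divr_gt0// powR_gt0.
have up : 0 < u by rewrite lt_def un0.
set l := (`|v| / u) `^ p.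
have l0 : 0 < l by rewrite powR_gt0// divr_gt0.
have lp : l `^ p^-1 = `|v| / u.
  by rewrite /l -powRrM mulfV ?gt_eqF// powRr1// divr_ge0// ltW.
have pV0 : 0 < p^-1 by rewrite invr_gt0.
rewrite (@measure_eq_null _ _ _ mu _ `[0, l]%classic (`]-oo, 0] `|` [set l]))//.
- by apply: (eq_trans (muE _)) => //; rewrite exponential_prob_itv0c// mulN1r.
- by apply: measurableU => //; exact: measurable_set1.
- by rewrite measureU0//; [exact: exponential_le0|exact: exponential_set1].
- move=> s /Ale us; have [s0|s0] := ltP 0 s; last by right; left; rewrite /= in_itv.
  left; rewrite /= in_itv/= (ltW s0)/= leNgt; apply/negP => ls.
  move: us; rewrite nE// leNgt => /negP; apply.
  rewrite ltr_pdivrMr ?powR_gt0// mulrC -ltr_pdivrMr// -lp.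
  by apply: gt0_ltr_powR => //; rewrite qualifE/= ltW.
- move=> s; rewrite /= in_itv/= => /andP[s0 sl].
  have [sp|sp] := ltP 0 s; last by right; left; rewrite in_itv.
  have [->|sl'] := eqVneq s l; first by right; right.
  left; apply: Alt; rewrite nE// ltr_pdivlMr ?powR_gt0// mulrC -ltr_pdivlMr// -lp.
  by apply: gt0_ltr_powR => //; rewrite ?qualifE/= ?ltW// lt_def eq_sym sl'.
Qed.

End ExponentialLaw.

(* [rel] stands for [<=] or [<]; the two agree because the law of [r x] is atomless. *)
Lemma transformed_integral (d : measure_display) (T : measurableType d)
    (R : realType) (P : probability T R) (K : finType) (r : K -> {RV P >-> R})
    (p : R) (nu : K -> R) (x : K) (k : nat) (phi : R -> R) (c : R) (rel : R -> R -> bool) :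
  0 < p -> nu x != 0 -> iid_exp1 r -> 0 <= c ->
  measurable_fun setT phi -> (forall t, 0 <= phi t) ->
  measurable [set z : R * R | rel z.1 z.2] ->
  (forall a b, a < b -> rel a b) -> (forall a b, rel a b -> a <= b) ->
  let nustar w := transformed p nu (fun y => r y w) in
  let t w := order_mag (zero_at (nustar w) x) k.+1 in
  (\int[P]_w (phi (t w) * (rel (c * t w) `|nustar w x|)%:R)%:E =
   \int[P]_w (phi (t w) * incl_prob p (nu x) (c * t w))%:E)%E.
Proof.
move=> p0 nux [indep law] c0 mphi phi0 mrel rellt relle nustar t.
pose g (y : K) (s : R) := nu y / s `^ p^-1.
have mg y : measurable_fun setT (g y).
  apply: measurable_funM => //; apply: (measurableT_comp (@invr_measurable R)).
  exact: measurable_powR.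
have mt : measurable_fun setT t.
  apply: (@measurable_order_mag _ _ _ _ (fun y w => zero_at (fun y => g y (r y w)) x y)) => y.
  rewrite /zero_at; case: (y == x) => //.
  exact: measurableT_comp (mg y) (measurable_funPT (r y)).
pose mt' := isMeasurableFun.Build _ _ _ _ _ mt.
pose Y : {RV P >-> R} := HB.pack t mt'.
pose A : set (R * R) := [set z | rel (c * z.2) `|g x z.1|].
have mA : measurable A.
  have mz : measurable_fun setT (fun z : R * R => (c * z.2, `|g x z.1|)).
    apply: measurable_fun_pair; first exact: measurable_funM.
    by apply: measurableT_comp => //; exact: measurableT_comp (mg x) measurable_fst.
  by have := mz measurableT _ mrel; rewrite setTI.
pose h (z : R * R) := (phi z.2 * \1_A z)%:E.
have h0 z : (0 <= h z)%E by rewrite lee_fin mulr_ge0.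
have mh : measurable_fun setT h.
  apply/measurable_EFinP/measurable_funM; last exact: measurable_indic.
  exact: measurableT_comp mphi measurable_snd.
transitivity (\int[P]_w h (r x w, Y w))%E.
  by apply: eq_integral => w _; rewrite /h indicE mem_setE.
rewrite (independent_integral _ mh h0)/=; last first.
  exact: (order_mag_independent x k indep mg).
apply: eq_integral => w _; rewrite /h.
have mAt : measurable [set s | A (s, t w)].
  have mp : measurable_fun setT (fun s : R => (s, t w)).
    exact: measurable_fun_pair (@measurable_id _ _ _) (measurable_cst _).
  by have := mp measurableT _ mA; rewrite setTI.
transitivity (\int[distribution P (r x)]_s
    ((phi (t w))%:E * (\1_[set s | A (s, t w)] s)%:E))%E.
  by apply: eq_integral => s _; rewrite -EFinM !indicE.
rewrite ge0_integralZl//=; [|exact/measurable_EFinP/measurable_indic|by rewrite lee_fin].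
rewrite integral_indic// setIT EFinM; congr (_ * _)%E.
apply: (exponential_law _ p0 nux) => //.
- by move=> B mB; exact: law.
- by rewrite mulr_ge0// order_mag_ge0.
- by move=> s /rellt.
- by move=> s /relle.
Qed.

(** * Pathwise bounds on the one-pass estimate *)

(** With [e <= 1/3], the cross term [27 * D * e ^+ 2] of [(1 + 3 * D * e) * (1 + 9 * e)] is at most
    [9 * D * e]; this explains [12 * D]. The 24 is dictated by the lower bound that follows. *)
Lemma estimate_ratio_le (R : realFieldType) (D e F F' Q Q' : R) :
  0 <= D -> 0 <= e -> e <= 3^-1 -> 0 <= F -> 0 < Q -> 0 <= F' -> 0 <= Q' ->
  F' <= F + 3 * D * e * F -> Q <= (1 + 9 * e) * Q' ->
  F' / Q' <= (1 + (12 * D + 24) * e) * (F / Q).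
Proof.
move=> D0 e0 e3 F0 Q0 F'0 Q'0 hF hQ.
have e90 : 0 < 1 + 9 * e by lra.
have {}Q'0 : 0 < Q' by rewrite -(pmulr_rgt0 _ e90) (lt_le_trans Q0).
have de0 : 0 <= D * e by rewrite mulr_ge0.
rewrite mulrA ler_pdivlMr// mulrAC ler_pdivrMr//.
apply: (@le_trans _ _ ((F + 3 * D * e * F) * ((1 + 9 * e) * Q'))).
  by apply: ler_pM => //; exact: ltW.
have -> : (F + 3 * D * e * F) * ((1 + 9 * e) * Q') =
  ((1 + 3 * D * e) * (1 + 9 * e)) * F * Q' by ring.
rewrite ler_wpM2r ?(ltW Q'0)// ler_wpM2r//.
have : D * e * e <= D * e * 3^-1 by rewrite ler_wpM2l.
lra.
Qed.

(** The coefficient 24 cancels the linear term of [(1 + 12 * e) ^+ 2]. The last hypothesis ensures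
    [0 < Q']. *)
Lemma estimate_ratio_ge (R : realFieldType) (D e F F' Q Q' : R) :
  0 <= D -> 0 <= e -> 0 <= F -> 0 < Q -> 0 <= F' -> 0 <= Q' ->
  F - 3 * D * e * F <= F' -> Q' <= (1 + 12 * e) ^+ 2 * Q -> Q <= (1 + 9 * e) * Q' ->
  (1 - (12 * D + 24) * e) * (F / Q) <= F' / Q'.
Proof.
move=> D0 e0 F0 Q0 F'0 Q'0 hF hQ hQ'.
have e90 : 0 < 1 + 9 * e by lra.
have {}Q'0 : 0 < Q' by rewrite -(pmulr_rgt0 _ e90) (lt_le_trans Q0).
have [C1|C1] := leP (1 - (12 * D + 24) * e) 0.
  by rewrite (@le_trans _ _ 0)// ?divr_ge0 ?(ltW Q'0)// mulr_le0_ge0// divr_ge0// ltW.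
rewrite mulrA ler_pdivrMr// mulrAC ler_pdivlMr//.
apply: (@le_trans _ _ ((1 - (12 * D + 24) * e) * F * ((1 + 12 * e) ^+ 2 * Q))).
  by rewrite ler_wpM2l// mulr_ge0// ltW.
rewrite mulrA ler_wpM2r ?(ltW Q0)// (le_trans _ hF)//.
have -> : F - 3 * D * e * F = (1 - 3 * D * e) * F by ring.
rewrite mulrAC ler_wpM2r//.
have de0 : 0 <= D * e by rewrite mulr_ge0.
have ee0 : 0 <= e * e by rewrite mulr_ge0.
have eee0 : 0 <= e * e * e by rewrite mulr_ge0.
have dee0 : 0 <= D * e * e by rewrite mulr_ge0.
have deee0 : 0 <= D * e * e * e by rewrite mulr_ge0.
rewrite expr2; lra.
Qed.

Section Pathwise.
Context {R : realType} {K : finType}.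
Variables (p eps D : R) (k : nat) (f : R -> R) (v r h : K -> R) (S : {set K}) (x : K).
Hypotheses (p02 : 0 < p <= 2) (eps0 : 0 <= eps) (eps3 : eps <= 3^-1) (D0 : 0 <= D).
Hypothesis f0 : forall w, 0 <= f w.
Hypothesis fD : forall w rho : R, 2/3 <= rho <= 2 ->
  `|f (rho * w) - f w| <= D * `|rho - 1| * f w.
Let tau := order_mag v k.+2.
Let t := order_mag (zero_at v x) k.+1.
Let htau := order_mag h k.+2.
Hypothesis hv : forall y, `|h y - v y| <= eps * tau.
Hypothesis topS : is_topk k.+1 h S.

Let est := worp_estimate p k.+1 f h r S x.

Let tau0 : 0 <= tau. Proof. exact: order_mag_ge0. Qed.
Let htau0 : 0 <= htau. Proof. exact: order_mag_ge0. Qed.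
Let t0 : 0 <= t. Proof. exact: order_mag_ge0. Qed.
Let etau0 : 0 <= eps * tau. Proof. exact: mulr_ge0. Qed.
Let tau_le_t : tau <= t. Proof. exact: order_mag_le_zero_at. Qed.

Let htau_le : htau <= (1 + eps) * tau.
Proof. by have := order_mag_perturb k.+1 etau0 hv; rewrite -/htau -/tau mulrDl mul1r. Qed.

Let htau_ge : (1 - eps) * tau <= htau.
Proof.
have vh y : `|v y - h y| <= eps * tau by rewrite distrC.
by have := order_mag_perturb k.+1 etau0 vh; rewrite -/htau -/tau mulrBl mul1r lerBlDr.
Qed.

Lemma worp_estimate_ge0 : 0 <= est.
Proof.
rewrite /est /worp_estimate /key_estimate; case: ifP => // _.
by rewrite divr_ge0// incl_prob_ge0.
Qed.

(** If [x] is sampled, [(1 - eps) * tau <= |h x| <= eps * tau], which with [eps <= 1/3] forces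
    [tau = 0] and [h x = 0]. *)
Lemma worp_estimate_eq0 : v x = 0 -> f 0 = 0 -> est = 0.
Proof.
move=> vx_eq0 f00; have e3 := eps3; rewrite /est /worp_estimate /key_estimate; case: ifPn => // xS.
have hx := topk_threshold topS xS; have := hv x.
rewrite vx_eq0 subr0 -/tau => hx'.
have tau_eq0 : tau = 0.
  apply/eqP; rewrite eq_le tau0 andbT leNgt; apply/negP => taup.
  have : eps * tau <= 3^-1 * tau by rewrite ler_wpM2r.
  have : 2/3 * tau <= (1 - eps) * tau by rewrite ler_wpM2r//; lra.
  move: (le_trans htau_ge (le_trans hx hx')) => A B C.
  by move: taup; apply/negP; rewrite -leNgt; lra.
have -> : h x = 0.
  by apply/eqP; rewrite -normr_le0 (le_trans hx')// tau_eq0 mulr0.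
by rewrite mul0r f00 mul0r.
Qed.

Hypothesis vn0 : v x != 0.
Hypothesis rx : 0 < r x.
Let vx0 : 0 < `|v x|. Proof. by rewrite normr_gt0. Qed.
Let freq := v x * r x `^ p^-1.
Let freq_neq0 : freq != 0.
Proof. by rewrite mulf_neq0// gt_eqF// powR_gt0. Qed.

(** A sampled key has [|h x| >= (1 - eps) * tau >= 2/3 * tau], so the additive error [eps * tau] is
    a relative error [3/2 * eps]. As this is at most [1/2], the sign is preserved and [rho] lies in
    [[2/3, 2]]. *)
Lemma sampled_ratio : x \in S -> exists rho : R,
  [/\ h x = rho * v x, 0 < rho, 2/3 <= rho <= 2, `|rho - 1| <= 3 * eps &
      1 <= rho * (1 + 3/2 * eps)].
Proof.
move=> xS; exists (h x / v x).
have hE : h x = h x / v x * v x by rewrite divfK.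
move: (h x / v x) hE => rho hE; have e0 := eps0; have e3 := eps3.
have H : `|rho - 1| <= 3/2 * eps * `|rho|.
  rewrite -(ler_pM2r vx0) -normrM mulrBl mul1r -hE (le_trans (hv x))//.
  have -> : 3/2 * eps * `|rho| * `|v x| = eps * (3/2 * `|h x|).
    by rewrite hE normrM; ring.
  rewrite ler_wpM2l// -/tau.
  have := le_trans htau_ge (topk_threshold topS xS).
  have : 2/3 * tau <= (1 - eps) * tau by rewrite ler_wpM2r//; lra.
  lra.
have H2 : `|rho - 1| <= 1/2 * `|rho|.
  by apply: (le_trans H); rewrite ler_wpM2r//; lra.
have rho_gt0 : 0 < rho.
  rewrite ltNge; apply/negP => rho_le0.
  move: H2; rewrite (ler0_norm rho_le0) distrC ger0_norm ?subr_ge0 ?(le_trans rho_le0)//.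
  by apply/negP; rewrite -ltNge; lra.
move: H H2; rewrite (gtr0_norm rho_gt0) => H.
rewrite ler_distl => /andP[H2 H3].
have rho2 : rho <= 2 by lra.
have erho : eps * rho <= eps * 2 by rewrite ler_wpM2l.
split => //.
- by apply/andP; split; lra.
- by apply: (le_trans H); lra.
- by move: H; rewrite ler_distl => /andP[]; lra.
Qed.

Lemma sampled_threshold : x \in S -> t <= (1 + 2 * eps) * tau.
Proof.
move=> xS; have := topk_zero_at_tau etau0 hv topS xS.
by rewrite -/t -/tau; lra.
Qed.

(** Two uses of [incl_prob_scale]. The factor [(1 + eps) * (1 + 3/2 * eps)] is at most
    [1 + 3 * eps], with square at most [1 + 9 * eps]; conversely [(1 + 3 * eps) * (1 + 2 * eps) * (1
    + 3/2 * eps)] is at most [1 + 12 * eps]. *)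
Lemma sampled_incl_prob : x \in S ->
  incl_prob p freq t <= (1 + 9 * eps) * incl_prob p (h x * r x `^ p^-1) htau /\
  incl_prob p (h x * r x `^ p^-1) htau <= (1 + 12 * eps) ^+ 2 * incl_prob p freq t.
Proof.
move=> xS; have [rho [-> rho0 /andP[_ rho2] rho3 rhoV]] := sampled_ratio xS.
have tle := sampled_threshold xS; have e0 := eps0; have e3 := eps3.
rewrite -[rho * v x * _]mulrA -/freq.
have nrho : `|rho * freq| = rho * `|freq| by rewrite normrM gtr0_norm.
have fr0 : 0 <= `|freq| by [].
have ee0 : 0 <= eps * eps by rewrite mulr_ge0.
have ee : eps * eps <= eps * 3^-1 by rewrite ler_wpM2l.
have eee : eps * eps * eps <= eps * 3^-1 * 3^-1 by rewrite ler_pM// mulr_ge0.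
(* For positive [eps], [(1 + 3/2 * eps) * (1 - eps) >= 1] holds exactly when [eps <= 1/3]. *)
have tau3 : tau <= (1 + 3/2 * eps) * htau.
  apply: (@le_trans _ _ ((1 + 3/2 * eps) * ((1 - eps) * tau))); last first.
    by rewrite ler_wpM2l//; lra.
  by rewrite mulrA ler_peMl//; lra.
split.
  apply: (@le_trans _ _ (((1 + eps) * (1 + 3/2 * eps)) ^+ 2 * incl_prob p (rho * freq) htau)).
    apply: incl_prob_scale => //.
    - move=> tt; apply/eqP; rewrite eq_le htau0 andbT (le_trans htau_le)//.
      by rewrite mulr_ge0_le0//; [lra|rewrite -tt].
    - lra.
    - rewrite nrho.
      apply: (@le_trans _ _ (`|freq| * ((1 + eps) * t))).
        rewrite ler_wpM2l// (le_trans htau_le)// ler_wpM2l//; lra.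
      have -> : (1 + eps) * (1 + 3 / 2 * eps) * (rho * `|freq| * t) =
        `|freq| * ((1 + eps) * t) * (rho * (1 + 3/2 * eps)) by ring.
      by rewrite ler_peMr// !mulr_ge0//; lra.
  rewrite ler_wpM2r ?incl_prob_ge0//.
  apply: (@le_trans _ _ ((1 + 3 * eps) ^+ 2)); last by rewrite expr2; lra.
  by rewrite lerXn2r// ?nnegrE; lra.
apply: incl_prob_scale => //.
- move=> ht; apply/eqP; rewrite eq_le t0 andbT (le_trans tle)//.
  have : tau <= 0 by move: tau3; rewrite ht mulr0.
  by move=> ?; rewrite mulr_ge0_le0//; lra.
- lra.
- rewrite nrho.
  apply: (@le_trans _ _ ((1 + 3 * eps) * `|freq| * ((1 + 2 * eps) * ((1 + 3/2 * eps) * htau)))).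
    apply: ler_pM => //; first by rewrite mulr_ge0// ltW.
      rewrite ler_wpM2r//; move: rho3; rewrite ler_distl => /andP[]; lra.
    by rewrite (le_trans tle)// ler_wpM2l//; lra.
  have -> : (1 + 3 * eps) * `|freq| * ((1 + 2 * eps) * ((1 + 3 / 2 * eps) * htau)) =
    ((1 + 3 * eps) * (1 + 2 * eps) * (1 + 3 / 2 * eps)) * (`|freq| * htau) by ring.
  by rewrite ler_wpM2r ?mulr_ge0//; lra.
Qed.

Let Q0 : 0 < incl_prob p freq t. Proof. exact: incl_prob_gt0. Qed.

Let sampled_f : x \in S ->
  `|f (h x * r x `^ p^-1) - f freq| <= 3 * D * eps * f freq.
Proof.
move=> xS; have [rho [-> _ rho2 rho3 _]] := sampled_ratio xS.
rewrite -[rho * v x * _]mulrA -/freq; apply: (le_trans (fD _ rho2)).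
by rewrite ler_wpM2r// [3 * D]mulrC -mulrA ler_wpM2l.
Qed.

(** Since [tau <= t], the slack [2 * eps * tau] in the sampling criterion becomes a multiple of [t],
    and the indicator compares [x] with a level set by the other keys. *)
Lemma worp_estimate_le : est <= (1 + (12 * D + 24) * eps) *
  (f freq / incl_prob p freq t) * ((1 - 2 * eps) * t <= `|v x|)%R%:R.
Proof.
rewrite /est /worp_estimate /key_estimate -/htau; case: ifPn => xS; last first.
  by rewrite !mulr_ge0// ?addr_ge0 ?mulr_ge0 ?addr_ge0 ?mulr_ge0 ?invr_ge0 ?(ltW Q0).
have -> : (1 - 2 * eps) * t <= `|v x|.
  have := topk_zero_at_le etau0 hv topS xS; rewrite -/t.
  have : eps * tau <= eps * t by rewrite ler_wpM2l.
  by move: (eps * tau) => a; rewrite mulrBl mul1r -mulrA; lra.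
rewrite mulr1; have [hQ _] := sampled_incl_prob xS.
have := sampled_f xS; rewrite ler_distl => /andP[_ hF].
exact: (estimate_ratio_le D0 eps0 eps3 (f0 _) Q0 (f0 _) (incl_prob_ge0 _ _ _) hF hQ).
Qed.

(** Beyond [(1 + 2 * eps) * t] sampling is certain by [topk_mem]; elsewhere nonnegativity of the
    estimate suffices. *)
Lemma worp_estimate_ge : (1 - (12 * D + 24) * eps) *
  (f freq / incl_prob p freq t) * ((1 + 2 * eps) * t < `|v x|)%R%:R <= est.
Proof.
have [lt1|_] := ltP ((1 + 2 * eps) * t) `|v x|; last by rewrite mulr0 worp_estimate_ge0.
rewrite mulr1; have xS : x \in S.
  apply: (topk_mem hv topS); rewrite -/t (le_lt_trans _ lt1)//.
  rewrite [leRHS]mulrDl mul1r -mulrA; apply: lerD => //.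
  by apply: ler_wpM2l => //; apply: ler_wpM2l.
rewrite /est /worp_estimate /key_estimate -/htau xS.
have [hQ' hQ] := sampled_incl_prob xS.
have := sampled_f xS; rewrite ler_distl => /andP[hF _].
exact: (estimate_ratio_ge D0 eps0 (f0 _) Q0 (f0 _) (incl_prob_ge0 _ _ _) hF hQ hQ').
Qed.

End Pathwise.

(** * Moments *)

Lemma measurable_bool_natr d (T : measurableType d) (R : realType) (b : T -> bool) :
  measurable_fun setT b -> measurable_fun setT (fun w => (b w)%:R : R).
Proof.
move=> mb; rewrite (_ : (fun w => _) = (fun w => if b w then 1 else 0)).
  exact: measurable_fun_ifT.
by apply/funext => w; case: (b w).
Qed.

Section Moments.
Context {d : measure_display} {T : measurableType d} {R : realType}.
Variables (P : probability T R) (K : finType) (r : K -> {RV P >-> R}).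
Variables (p c F : R) (nu : K -> R) (x : K) (k : nat).
Hypotheses (p02 : 0 < p <= 2) (nux : nu x != 0) (rP : iid_exp1 r) (c0 : 0 <= c) (F0 : 0 <= F).
Let nustar w := transformed p nu (fun y => r y w).
Let t w := order_mag (zero_at (nustar w) x) k.+1.
Let q s := incl_prob p (nu x) s.

Let p0 : 0 < p. Proof. by case/andP: p02. Qed.
Let q_ge0 s : 0 <= q s. Proof. exact: incl_prob_ge0. Qed.
Let t_ge0 w : 0 <= t w. Proof. exact: order_mag_ge0. Qed.
Let qt_gt0 w : 0 < q (t w). Proof. exact: incl_prob_gt0. Qed.
Let Fq_ge0 s : 0 <= F / q s. Proof. by rewrite divr_ge0. Qed.

Let mnustar y : measurable_fun setT (fun w => nustar w y).
Proof.
apply: measurable_funM => //; apply: (measurableT_comp (@invr_measurable R)).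
exact: (measurableT_comp (measurable_powR _)) (measurable_funPT (r y)).
Qed.

Let mt : measurable_fun setT t.
Proof.
apply: (@measurable_order_mag _ _ _ _ (fun y w => zero_at (nustar w) x y)) => y.
by rewrite /zero_at; case: (y == x) => //; exact: mnustar.
Qed.

Let mq : measurable_fun setT q.
Proof. exact: measurable_incl_prob. Qed.

Let mFq : measurable_fun setT (fun s => F / q s).
Proof. by apply: measurable_funM => //; exact: measurableT_comp (@invr_measurable R) mq. Qed.

Lemma incl_prob_dilate (e s : R) : 0 <= e <= 3^-1 -> 0 <= s ->
  q ((1 - 2 * e) * s) <= (1 + 24 * e) * q s.
Proof.
move=> /andP[e0 e3] s0; have a0 : 0 < 1 - 2 * e by lra.
apply: (@le_trans _ _ ((1 - 2 * e)^-1 ^+ 2 * q s)).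
  apply: incl_prob_scale => //; first by rewrite mulr_ge0// ltW.
  - by move/eqP; rewrite mulf_eq0 (gt_eqF a0) => /eqP.
  - by rewrite invf_ge1//; lra.
  - by rewrite [X in _ <= _ * X]mulrCA mulKf ?gt_eqF.
rewrite ler_wpM2r// exprVn -[leLHS]mul1r ler_pdivrMr ?exprn_gt0//.
(* This product equals [(1 - 2 * e) ^+ 2 * (1 + 24 * e) - 1]; the coefficient 24 places a root at
   [e = 1/3]. *)
have H : 0 <= e * ((3^-1 - e) * (60 - 96 * e)) by rewrite !mulr_ge0//; lra.
by rewrite expr2; lra.
Qed.

Lemma incl_prob_shrink (e s : R) : 0 <= e -> 0 <= s ->
  (1 - 4 * e) * q s <= q ((1 + 2 * e) * s).
Proof.
move=> e0 s0; have [e4|e4] := leP (1 - 4 * e) 0.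
  by rewrite (@le_trans _ _ 0)// mulr_le0_ge0.
have a1 : 1 <= 1 + 2 * e by lra.
have H : q s <= (1 + 2 * e) ^+ 2 * q ((1 + 2 * e) * s).
  apply: incl_prob_scale => //; first by rewrite mulr_ge0//; lra.
  - by move=> ->; rewrite mulr0.
  - by rewrite mulrCA.
apply: (le_trans (ler_wpM2l (ltW e4) H)).
rewrite mulrA ler_piMl//.
have -> : (1 - 4 * e) * (1 + 2 * e) ^+ 2 = 1 - (12 * e ^+ 2 + 16 * e ^+ 3) by ring.
by rewrite lerBlDr lerDl addr_ge0 ?mulr_ge0 ?exprn_ge0.
Qed.


Section Transfer.
Variables (phi : R -> R) (a : R) (Y : T -> R).
Hypotheses (a0 : 0 <= a) (mphi : measurable_fun setT phi) (phi0 : forall s, 0 <= phi s).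
Hypotheses (mY : measurable_fun setT Y) (Y0 : forall w, 0 <= Y w).

Let mle : measurable [set z : R * R | z.1 <= z.2].
Proof.
have := @measurable_fun_ler _ _ R setT _ _ (@measurable_fst _ _ R R) (@measurable_snd _ _ R R).
by move=> /(_ measurableT [set true] I); rewrite setTI.
Qed.

Let mlt : measurable [set z : R * R | z.1 < z.2].
Proof.
have := @measurable_fun_ltr _ _ R setT _ _ (@measurable_fst _ _ R R) (@measurable_snd _ _ R R).
by move=> /(_ measurableT [set true] I); rewrite setTI.
Qed.

Let mat : measurable_fun setT (fun w => a * t w).
Proof. exact: measurable_funM. Qed.

Let mabs : measurable_fun setT (fun w => `|nustar w x|).
Proof. exact: measurableT_comp (mnustar x). Qed.

Let mphit : measurable_fun setT (fun w => phi (t w)).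
Proof. exact: measurableT_comp mphi mt. Qed.

(** Integrating out [r x] turns the indicator into its conditional probability [q (a * t)] given the
    other keys. *)
Lemma integral_le_transformed :
  {ae P, forall w, Y w <= phi (t w) * (a * t w <= `|nustar w x|)%R%:R} ->
  (\int[P]_w (Y w)%:E <= \int[P]_w (phi (t w) * q (a * t w))%:E)%E.
Proof.
move=> YU.
rewrite -(@transformed_integral _ _ _ _ _ _ _ _ x k phi a (fun u v => u <= v) p0 nux rP)//;
  last by move=> u v /ltW.
apply: ae_ge0_le_integral => //=.
- by move=> w _; rewrite lee_fin.
- exact/measurable_EFinP.
- by move=> w _; rewrite lee_fin mulr_ge0.
- apply/measurable_EFinP/(measurable_funM mphit).
  exact/measurable_bool_natr/measurable_fun_ler.
- by apply: filterS YU => w + _; rewrite lee_fin.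
Qed.

Lemma integral_ge_transformed :
  {ae P, forall w, phi (t w) * (a * t w < `|nustar w x|)%R%:R <= Y w} ->
  (\int[P]_w (phi (t w) * q (a * t w))%:E <= \int[P]_w (Y w)%:E)%E.
Proof.
move=> YL.
rewrite -(@transformed_integral _ _ _ _ _ _ _ _ x k phi a (fun u v => u < v) p0 nux rP)//;
  last by move=> u v /ltW.
apply: ae_ge0_le_integral => //=.
- by move=> w _; rewrite lee_fin mulr_ge0.
- apply/measurable_EFinP/(measurable_funM mphit).
  exact/measurable_bool_natr/measurable_fun_ltr.
- by move=> w _; rewrite lee_fin.
- exact/measurable_EFinP.
- by apply: filterS YL => w + _; rewrite lee_fin.
Qed.

End Transfer.

(** The second moment of the perfect estimate, which is [F / q t] with conditional probability
    [q t]; the yardstick for both samples. *)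
Definition second_moment : \bar R := (\int[P]_w (F ^+ 2 / q (t w))%:E)%E.

Let mqt a : measurable_fun setT (fun w => q (a * t w)).
Proof. apply: measurableT_comp mq _; exact: measurable_funM. Qed.

Let m2 : measurable_fun setT (fun w => F ^+ 2 / q (t w)).
Proof.
apply: measurable_funM => //.
exact: measurableT_comp (@invr_measurable R) (measurableT_comp mq mt).
Qed.

Variables (X : T -> R) (e : R).
Hypotheses (mX : measurable_fun setT X) (X0 : forall w, 0 <= X w).
Hypothesis e03 : 0 <= e <= 3^-1.

Section Upper.
Hypothesis XU : {ae P, forall w, X w <=
  (1 + c * e) * (F / q (t w)) * ((1 - 2 * e) * t w <= `|nustar w x|)%R%:R}.

Let ce0 : 0 <= 1 + c * e.
Proof. by case/andP: e03 => e0 _; rewrite addr_ge0// mulr_ge0. Qed.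
Let e20 : 0 <= 1 - 2 * e.
Proof. by case/andP: e03 => ? ?; lra. Qed.
Let e240 : 0 <= 1 + 24 * e.
Proof. by case/andP: e03 => ? ?; lra. Qed.

(** The divisor [q t] cancels against [q ((1 - 2 * e) * t)] up to [1 + 24 * e], leaving a constant
    integrand. *)
Lemma first_moment_le :
  (\int[P]_w (X w)%:E <= ((1 + c * e) * (1 + 24 * e) * F)%:E)%E.
Proof.
pose phi s := (1 + c * e) * (F / q s).
have phi0 s : 0 <= phi s by rewrite mulr_ge0.
have mphi : measurable_fun setT phi by exact: measurable_funM.
apply: (le_trans (integral_le_transformed e20 mphi phi0 mX X0 XU)).
apply: (@le_trans _ _ (\int[P]_w ((1 + c * e) * (1 + 24 * e) * F)%:E)%E).
  apply: ge0_le_integral => //=.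
  - by move=> w _; rewrite lee_fin mulr_ge0.
  - apply/measurable_EFinP.
    exact: measurable_funM (measurableT_comp mphi mt) (mqt _).
  - move=> w _; rewrite lee_fin /phi -!mulrA ler_wpM2l//.
    rewrite [leRHS]mulrC; apply: ler_wpM2l => //; rewrite mulrC ler_pdivrMr//.
    exact: incl_prob_dilate.
by rewrite integral_cst//= probability_setT mule1.
Qed.

(** After squaring, the same cancellation leaves one factor [1 / q t]. *)
Lemma second_moment_le :
  (\int[P]_w (X w ^+ 2)%:E <= ((1 + c * e) ^+ 2 * (1 + 24 * e))%:E * second_moment)%E.
Proof.
pose phi s := ((1 + c * e) * (F / q s)) ^+ 2.
have phi0 s : 0 <= phi s by exact: sqr_ge0.
have mphi : measurable_fun setT phi by apply: measurable_funX; exact: measurable_funM.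
have mX2 : measurable_fun setT (fun w => X w ^+ 2) by exact: measurable_funX.
have X20 w : 0 <= X w ^+ 2 by exact: sqr_ge0.
have XU2 : {ae P, forall w, X w ^+ 2 <=
    phi (t w) * ((1 - 2 * e) * t w <= `|nustar w x|)%R%:R}.
  apply: filterS XU => w Xw; rewrite /phi.
  have X0w := X0 w; move: Xw; case: (_ * _ <= _); rewrite ?mulr1 ?mulr0 => Xw.
    by rewrite lerXn2r// qualifE/= (le_trans X0w).
  by have /eqP -> : X w == 0; [rewrite eq_le Xw|rewrite expr0n].
apply: (le_trans (integral_le_transformed e20 mphi phi0 mX2 X20 XU2)).
rewrite /second_moment -ge0_integralZl//=; last 3 first.
- exact/measurable_EFinP.
- by move=> w _; rewrite lee_fin divr_ge0// sqr_ge0.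
- by rewrite lee_fin mulr_ge0// sqr_ge0.
apply: ge0_le_integral => //=.
- by move=> w _; rewrite lee_fin mulr_ge0.
- apply/measurable_EFinP.
  exact: measurable_funM (measurableT_comp mphi mt) (mqt _).
- by apply/measurable_EFinP; apply: measurable_funM.
- move=> w _; rewrite -EFinM lee_fin /phi exprMn -[leLHS]mulrA -[leRHS]mulrA.
  apply: ler_wpM2l; first exact: sqr_ge0.
  have -> : (1 + 24 * e) * (F ^+ 2 / q (t w)) =
    (F / q (t w)) ^+ 2 * ((1 + 24 * e) * q (t w)).
    by field; rewrite gt_eqF.
  by apply: ler_wpM2l; [exact: sqr_ge0|exact: incl_prob_dilate].
Qed.

End Upper.

Lemma first_moment_ge :
  {ae P, forall w, (1 - c * e) * (F / q (t w)) *
    ((1 + 2 * e) * t w < `|nustar w x|)%R%:R <= X w} ->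
  (((1 - (c + 4) * e) * F)%:E <= \int[P]_w (X w)%:E)%E.
Proof.
move=> XL; have /andP[e0 _] := e03.
have intX0 : (0 <= \int[P]_w (X w)%:E)%E.
  by apply: integral_ge0 => w _; rewrite lee_fin.
have [b0|b0] := leP ((1 - (c + 4) * e) * F) 0; first by rewrite (le_trans _ intX0).
(* The transfer lemma needs a nonnegative [phi]; otherwise the claimed bound is nonpositive and
   trivial. *)
have [c1|c1] := leP (1 - c * e) 0.
  rewrite (le_trans _ intX0)// lee_fin mulr_le0_ge0// mulrDl opprD addrA.
  by rewrite (le_trans _ c1)// lerBlDr lerDl mulr_ge0.
pose phi s := (1 - c * e) * (F / q s).
have phi0 s : 0 <= phi s by rewrite mulr_ge0// ltW.
have mphi : measurable_fun setT phi by exact: measurable_funM.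
have a0 : 0 <= 1 + 2 * e by rewrite addr_ge0// mulr_ge0.
apply: le_trans (integral_ge_transformed a0 mphi phi0 mX X0 XL).
rewrite -[leLHS]mule1 -(@probability_setT _ _ _ P) -integral_cst//.
apply: ge0_le_integral => //=.
- by move=> w _; rewrite lee_fin ltW.
- apply/measurable_EFinP.
  exact: measurable_funM (measurableT_comp mphi mt) (mqt _).
- move=> w _; rewrite lee_fin /phi.
  have -> : (1 - c * e) * (F / q (t w)) * q ((1 + 2 * e) * t w) =
    (1 - c * e) * F * (q ((1 + 2 * e) * t w) / q (t w)) by ring.
  apply: (@le_trans _ _ ((1 - c * e) * F * (1 - 4 * e))).
    rewrite mulrAC; apply: ler_wpM2r => //.
    have -> : (1 - c * e) * (1 - 4 * e) = 1 - (c + 4) * e + 4 * (c * e ^+ 2) by ring.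
    by rewrite lerDl !mulr_ge0// sqr_ge0.
  apply: ler_wpM2l; first by rewrite mulr_ge0// ltW.
  by rewrite ler_pdivlMr//; exact: incl_prob_shrink.
Qed.

Lemma second_moment_ge :
  {ae P, forall w, (F / q (t w)) * (t w < `|nustar w x|)%R%:R <= X w} ->
  (second_moment <= \int[P]_w (X w ^+ 2)%:E)%E.
Proof.
move=> XL; pose phi s := (F / q s) ^+ 2.
have phi0 s : 0 <= phi s by exact: sqr_ge0.
have mphi : measurable_fun setT phi by exact: measurable_funX.
have mX2 : measurable_fun setT (fun w => X w ^+ 2) by exact: measurable_funX.
have X20 w : 0 <= X w ^+ 2 by exact: sqr_ge0.
have XL2 : {ae P, forall w,
    phi (t w) * (1 * t w < `|nustar w x|)%R%:R <= X w ^+ 2}.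
  apply: filterS XL => w; rewrite mul1r /phi; case: (_ < _); rewrite ?mulr1 ?mulr0 => Xw //.
  by apply: lerXn2r; rewrite // qualifE/=.
apply: le_trans (integral_ge_transformed ler01 mphi phi0 mX2 X20 XL2).
rewrite le_eqVlt; apply/orP; left; apply/eqP; apply: eq_integral => w _.
rewrite /phi mul1r; congr EFin.
by field; rewrite gt_eqF.
Qed.

End Moments.

(** * Bias and mean squared error from moments *)

Section BiasMse.
Context {d : measure_display} {T : measurableType d} {R : realType}.
Variable P : probability T R.

(** The expanded square is arranged with sums of nonnegative terms only, so that infinite second
    moments cause no undefined difference. *)
Lemma integral_sqr_sub (X : T -> R) (F : R) :
  measurable_fun setT X -> (forall w, 0 <= X w) -> 0 <= F ->
  (\int[P]_w ((X w - F) ^+ 2)%:E + (2 * F)%:E * \int[P]_w (X w)%:E =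
   \int[P]_w (X w ^+ 2)%:E + (F ^+ 2)%:E)%E.
Proof.
move=> mX X0 F0.
have mXF : measurable_fun setT (fun w => (X w - F) ^+ 2).
  by apply: measurable_funX; exact: measurable_funB.
have mX2 : measurable_fun setT (fun w => X w ^+ 2) by exact: measurable_funX.
rewrite -ge0_integralZl//=; [|exact/measurable_EFinP|by move=> w _; rewrite lee_fin|];
  last by rewrite lee_fin mulr_ge0.
rewrite -[in RHS](mule1 (F ^+ 2)%:E) -(@probability_setT _ _ _ P) -integral_cst//.
rewrite -!ge0_integralD//=.
- by apply: eq_integral => w _; rewrite -EFinM -!EFinD; congr EFin; ring.
- by move=> w _; rewrite lee_fin sqr_ge0.
- exact/measurable_EFinP.
- by move=> w _; rewrite lee_fin sqr_ge0.
- by move=> w _; rewrite lee_fin sqr_ge0.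
- exact/measurable_EFinP.
- by move=> w _; rewrite lee_fin !mulr_ge0.
- exact/measurable_EFinP/measurable_funM.
Qed.

(** As [M] is at most the second moment of [X'], that is variance plus [F ^+ 2], the error is at
    most [(1 + c) * (V + F ^+ 2) - 2 * (1 - c) * F ^+ 2 + F ^+ 2 = (1 + c) * V + 3 * c * F ^+ 2]. *)
Lemma bias_mse_le (X X' : T -> R) (F c : R) (M : \bar R) :
  measurable_fun setT X -> (forall w, 0 <= X w) ->
  measurable_fun setT X' -> (forall w, 0 <= X' w) -> 0 <= F -> 0 <= c ->
  (((1 - c) * F)%:E <= \int[P]_w (X w)%:E)%E ->
  (\int[P]_w (X w)%:E <= ((1 + c) * F)%:E)%E ->
  (\int[P]_w (X w ^+ 2)%:E <= (1 + c)%:E * M)%E ->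
  (\int[P]_w (X' w)%:E = F%:E)%E ->
  (M <= \int[P]_w (X' w ^+ 2)%:E)%E ->
  (bias P X F <= (c * F)%:E)%E /\
  (mse P X F <= (1 + 3 * c)%:E * 'V_P[X'] + (3 * c * F ^+ 2)%:E)%E.
Proof.
move=> mX X0 mX' X'0 F0 c0 lo up up2 X'F lo2.
have [m mE] : exists m, (\int[P]_w (X w)%:E = m%:E)%E.
  exists (fine (\int[P]_w (X w)%:E)%E); rewrite fineK// ge0_fin_numE.
    by rewrite (le_lt_trans up)// ltry.
  by apply: integral_ge0 => w _; rewrite lee_fin.
move: lo up; rewrite mE !lee_fin => lo up.
split.
  rewrite /bias expectation.unlock mE -EFinB /= lee_fin ler_distl.
  by apply/andP; split; lra.
rewrite /mse /variance covariance.unlock !expectation.unlock X'F /=.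
have := integral_sqr_sub mX X0 F0; have := integral_sqr_sub mX' X'0 F0.
rewrite mE X'F.
have -> : (\int[P]_w (((X' \- cst F) * (X' \- cst F))%R w)%:E =
  \int[P]_w ((X' w - F) ^+ 2)%:E)%E.
  by apply: eq_integral => w _; rewrite expr2.
have : (0 <= \int[P]_w ((X' w - F) ^+ 2)%:E)%E.
  by apply: integral_ge0 => w _; rewrite lee_fin sqr_ge0.
have : (0 <= \int[P]_w (X w ^+ 2)%:E)%E.
  by apply: integral_ge0 => w _; rewrite lee_fin sqr_ge0.
move: up2 lo2.
move: (\int[P]_w (X w ^+ 2)%:E)%E (\int[P]_w (X' w ^+ 2)%:E)%E
  (\int[P]_w ((X w - F) ^+ 2)%:E)%E (\int[P]_w ((X' w - F) ^+ 2)%:E)%E => A A' B V.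
have c31 : 0 < 1 + 3 * c by rewrite ltr_pwDl// mulr_ge0.
(* With infinite variance the right-hand side is [+oo]; otherwise all the moments are finite. *)
case: V => [v| |] // up2 lo2 A0 v0 eV eA; last first.
  by rewrite gt0_muley ?lte_fin// addye// leey.
have up3 : (A <= (1 + c)%:E * A')%E.
  by rewrite (le_trans up2)// lee_wpmul2l// lee_fin addr_ge0.
case: A' eV up3 {up2 lo2} => [a'| |] //=; rewrite -EFinM -!EFinD => -[eV].
case: A A0 eA => [a| |] // A0; case: B => [b| |] //=.
rewrite -!EFinM -!EFinD !lee_fin => -[eA] aa'.
have cv : c * (v + 2 * F * F) = c * (a' + F ^+ 2) by rewrite eV.
have cF : 0 <= c * F * F by rewrite !mulr_ge0.
have lo' : 2 * F * ((1 - c) * F) <= 2 * F * m by rewrite ler_wpM2l// mulr_ge0.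
have cv0 : 0 <= c * v by rewrite mulr_ge0.
by move: eV eA aa' lo' cv; rewrite !expr2; lra.
Qed.

End BiasMse.

(** * Measurability of the estimates and choice of constants *)

Lemma measurable_key_estimate (d : measure_display) (T : measurableType d) (R : realType)
    (K : finType) (p : R) (f : R -> R) (S : T -> {set K}) (freq : T -> K -> R)
    (tau : T -> R) (x : K) :
  measurable_fun setT f -> measurable [set w | x \in S w] ->
  measurable_fun setT (fun w => freq w x) -> measurable_fun setT tau ->
  measurable_fun setT (fun w => key_estimate p f (S w) (freq w) (tau w) x).
Proof.
move=> mf mS mfreq mtau; apply: measurable_fun_ifT => //.
  by apply: (measurable_fun_bool true); rewrite setTI.
apply: measurable_funM; first exact: measurableT_comp mf mfreq.
apply: (measurableT_comp (@invr_measurable R)).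
exact: measurable_incl_prob.
Qed.

Lemma exp1_gt0 (d : measure_display) (T : measurableType d) (R : realType)
    (P : probability T R) (K : finType) (r : K -> {RV P >-> R}) (x : K) :
  iid_exp1 r -> {ae P, forall w, 0 < r x w}.
Proof.
move=> [_ law]; exists (r x @^-1` `]-oo, 0]%classic); split.
- exact: measurable_funPTI.
- by apply: (@exponential_le0 R (distribution P (r x))) => A mA; exact: law.
- by move=> w /= /negP; rewrite -leNgt in_itv.
Qed.

(** From [e ^+ 2 <= e] comes [(1 + a * e) ^+ 2 <= 1 + A * e], and [24 * A * e <= 8 * A] gives the
    coefficient [24 + 9 * A]. *)
Lemma distortion_bound (R : realFieldType) (a e : R) : 0 <= a -> 0 <= e -> e <= 3^-1 ->
  (1 + a * e) ^+ 2 * (1 + 24 * e) <= 1 + (24 + 9 * (2 * a + a ^+ 2)) * e.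
Proof.
move=> a0 e0 e3; set A := 2 * a + a ^+ 2.
have A0 : 0 <= A by rewrite addr_ge0 ?mulr_ge0 ?sqr_ge0.
have ae : (1 + a * e) ^+ 2 <= 1 + A * e.
  have -> : (1 + a * e) ^+ 2 = 1 + 2 * a * e + a ^+ 2 * (e * e) by ring.
  have -> : 1 + A * e = 1 + 2 * a * e + a ^+ 2 * e by rewrite /A; ring.
  rewrite lerD2l; apply: ler_wpM2l; first exact: sqr_ge0.
  by rewrite ler_piMl//; lra.
apply: (@le_trans _ _ ((1 + A * e) * (1 + 24 * e))); first by rewrite ler_wpM2r//; lra.
have -> : (1 + A * e) * (1 + 24 * e) = 1 + (24 + A + 24 * A * e) * e by ring.
rewrite lerD2l ler_wpM2r//.
have : A * e <= A * 3^-1 by rewrite ler_wpM2l.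
by move: A A0 {ae} => A A0; lra.
Qed.

Theorem theorem5p1 (R : realType) (c : R) (c_gt0 : 0 < c) :
  exists C : R, 0 < C /\
  forall (d : measure_display) (T : measurableType d) (P : probability T R)
    (K : finType) (p : R) (k : nat) (nu : K -> R) (eps : R) (f : R -> R)
    (r nuhat : K -> {RV P >-> R}) (S S' : T -> {set K}),
  0 < p <= 2 ->
  (1 <= k)%N ->
  0 < eps <= 3^-1 ->
  (forall w, 0 <= f w) ->
  (forall w e, 0 <= e <= 2^-1 -> `|f ((1 + e) * w) - f w| <= c * e * f w) ->
  iid_exp1 r ->
  let nustar (w : T) : K -> R := transformed p nu (fun x => r x w) in
  {ae P, forall w, forall x,
    `|nuhat x w - nustar w x| <= eps * order_mag (nustar w) k.+1} ->
  topk_sample k nuhat S ->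
  topk_sample k (fun x w => nustar w x) S' ->
  forall x : K, (nu x = 0 -> f 0 = 0) ->
  let est (w : T) : R :=
    worp_estimate p k f (fun y => nuhat y w) (fun y => r y w) (S w) x in
  let est' (w : T) : R :=
    ppswor_estimate p k f nu (fun y => r y w) (S' w) x in
  (bias P est (f (nu x)) <= (C * eps * f (nu x))%:E)%E /\
  (mse P est (f (nu x)) <=
     (1 + C * eps)%:E * 'V_P[est'] + (C * eps * f (nu x) ^+ 2)%:E)%E.
Proof.
pose D := dilation_constant c.
have D0 : 0 <= D.
  rewrite /D /dilation_constant addr_ge0 ?sqr_ge0//.
  by rewrite mulr_ge0 ?addr_ge0 ?mulr_ge0 ?exprn_ge0// ltW.
(* [C1] is the pathwise distortion, [C2] that of the moments by [distortion_bound]; the factor 3 in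
   the witness comes from [bias_mse_le]. *)
pose C1 := 12 * D + 24.
have C10 : 0 <= C1 by rewrite addr_ge0 ?mulr_ge0.
pose C2 := 24 + 9 * (2 * C1 + C1 ^+ 2).
have C20 : 0 < C2 by rewrite ltr_wpDr// mulr_ge0// addr_ge0 ?sqr_ge0 ?mulr_ge0.
have C1C2 : C1 + 4 <= C2 by rewrite /C2; have := sqr_ge0 C1; lra.
exists (3 * C2); split; first by rewrite mulr_gt0.
move=> d T P K p [//|k] nu eps f r nuhat S S' p02 _ /andP[/ltW e0 e3] f0 fc rP nustar.
move=> hv [topS mS] [topS' mS'] x nu0 est est'.
have fD := dilation_lipschitz c_gt0 f0 fc.
have mf := dilation_lipschitz_measurable fD.
have rx := exp1_gt0 x rP.
have mnustar y : measurable_fun setT (fun w => nustar w y).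
  apply: measurable_funM => //; apply: (measurableT_comp (@invr_measurable R)).
  exact: (measurableT_comp (measurable_powR _)) (measurable_funPT (r y)).
have mest : measurable_fun setT est.
  apply: measurable_key_estimate => //.
    apply: measurable_funM => //.
    exact: (measurableT_comp (measurable_powR _)) (measurable_funPT (r x)).
  by apply: (@measurable_order_mag _ _ _ _ (fun y w => nuhat y w)).
have mest' : measurable_fun setT est'.
  apply: measurable_key_estimate => //.
  exact: (@measurable_order_mag _ _ _ _ (fun y w => nustar w y)).
have est0 w : 0 <= est w by exact: worp_estimate_ge0.
have est'0 w : 0 <= est' w.
  rewrite /est' /ppswor_estimate /key_estimate; case: ifP => // _.
  by rewrite divr_ge0// incl_prob_ge0.
have F0 := f0 (nu x).
have C2e : 0 <= C2 * eps by rewrite mulr_ge0// ltW.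
suff [bi ms] : (bias P est (f (nu x)) <= (C2 * eps * f (nu x))%:E)%E /\
    (mse P est (f (nu x)) <= (1 + 3 * (C2 * eps))%:E * 'V_P[est'] +
     (3 * (C2 * eps) * f (nu x) ^+ 2)%:E)%E.
  split; last by rewrite -[3 * C2 * eps]mulrA.
  by rewrite (le_trans bi)// lee_fin ler_wpM2r// -mulrA ler_peMl// ler1n.
(* At frequency 0 the inclusion probability may vanish, so this case is separate: both estimates are
   almost surely 0. *)
have [nux0|nux] := eqVneq (nu x) 0.
  have F00 : f (nu x) = 0 by rewrite nux0 nu0.
  have est_eq0 : {ae P, forall w, est w = 0}.
    apply: filterS hv => w hvw.
    apply: (worp_estimate_eq0 _ _ e0 e3 hvw (topS w)); last exact: nu0.
    by rewrite /nustar /transformed nux0 mul0r.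
  have est'_eq0 w : est' w = 0.
    by rewrite /est' /ppswor_estimate /key_estimate F00 mul0r; case: ifP.
  have int_est n : (0 < n)%N -> (\int[P]_w (est w ^+ n)%:E = 0)%E.
    move=> n0; rewrite -[RHS](@integral0 _ _ _ P setT); apply: ae_eq_integral => //.
      by apply/measurable_EFinP; exact: (measurable_funX n mest).
    by apply: filterS est_eq0 => w -> _; rewrite expr0n gtn_eqF.
  have int_est' n : (0 < n)%N -> (\int[P]_w (est' w ^+ n)%:E = 0)%E.
    move=> n0; rewrite -[RHS](@integral0 _ _ _ P setT); apply: eq_integral => w _.
    by rewrite est'_eq0 expr0n gtn_eqF.
  rewrite F00; apply: (@bias_mse_le _ _ _ P est est' _ _ 0%E) => //.
  - by rewrite (int_est 1%N)// mulr0.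
  - by rewrite (int_est 1%N)// mulr0.
  - by rewrite int_est// mule0.
  - exact: (int_est' 1%N).
  - by rewrite int_est'.
set q := incl_prob p (nu x).
pose t w := order_mag (zero_at (nustar w) x) k.+1.
have freqE w : 0 < r x w -> nustar w x * r x w `^ p^-1 = nu x.
  by move=> rxw; rewrite /nustar /transformed divfK// gt_eqF// powR_gt0.
have nustar0 w : 0 < r x w -> nustar w x != 0.
  by move=> rxw; rewrite /nustar /transformed mulf_neq0// invr_neq0// gt_eqF// powR_gt0.
(* The perfect estimate is the one-pass estimate of error 0, so the pathwise bounds apply to it with
   [eps] replaced by 0. *)
have est'E w : 0 < r x w -> est' w =
    worp_estimate p k.+1 f (nustar w) (fun y => r y w) (S' w) x.
  by move=> rxw; rewrite /worp_estimate /key_estimate freqE.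
have hv0 w y : `|nustar w y - nustar w y| <= 0 * order_mag (nustar w) k.+2.
  by rewrite subrr normr0 mul0r.
have z3 : 0 <= 3^-1 :> R by rewrite invr_ge0.
have XU : {ae P, forall w, est w <=
    (1 + C1 * eps) * (f (nu x) / q (t w)) * ((1 - 2 * eps) * t w <= `|nustar w x|)%R%:R}.
  apply: filterS2 hv rx => w hvw rxw.
  have := worp_estimate_le (r := fun y => r y w) p02 e0 e3 D0 f0 fD 
    hvw (topS w) (nustar0 w rxw) rxw.
  by rewrite freqE.
have XL : {ae P, forall w, (1 - C1 * eps) * (f (nu x) / q (t w)) *
    ((1 + 2 * eps) * t w < `|nustar w x|)%R%:R <= est w}.
  apply: filterS2 hv rx => w hvw rxw.
  have := worp_estimate_ge (r := fun y => r y w) p02 e0 e3 D0 f0 fD 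
    hvw (topS w) (nustar0 w rxw) rxw.
  by rewrite freqE.
have X'U : {ae P, forall w, est' w <=
    (1 + C1 * 0) * (f (nu x) / q (t w)) * ((1 - 2 * 0) * t w <= `|nustar w x|)%R%:R}.
  apply: filterS rx => w rxw; rewrite est'E//.
  have := worp_estimate_le (r := fun y => r y w) p02 (lexx 0) z3 D0 f0 fD 
    (hv0 w) (topS' w) (nustar0 w rxw) rxw.
  by rewrite freqE.
have X'L : {ae P, forall w, (1 - C1 * 0) * (f (nu x) / q (t w)) *
    ((1 + 2 * 0) * t w < `|nustar w x|)%R%:R <= est' w}.
  apply: filterS rx => w rxw; rewrite est'E//.
  have := worp_estimate_ge (r := fun y => r y w) p02 (lexx 0) z3 D0 f0 fD 
    (hv0 w) (topS' w) (nustar0 w rxw) rxw.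
  by rewrite freqE.
have e03 : 0 <= eps <= 3^-1 by rewrite e0.
have z03 : 0 <= (0 : R) <= 3^-1 by rewrite lexx.
have dist2 := distortion_bound C10 e0 e3.
have dist1 : (1 + C1 * eps) * (1 + 24 * eps) <= 1 + C2 * eps.
  apply: le_trans dist2; rewrite ler_wpM2r ?addr_ge0 ?mulr_ge0//.
  by rewrite expr2 ler_peMl ?lerDl ?addr_ge0 ?mulr_ge0.
apply: (@bias_mse_le _ _ _ P est est' _ _ (second_moment r p (f (nu x)) nu x k)) => //.
- apply: le_trans (first_moment_ge p02 nux rP C10 F0 mest est0 e03 XL).
  by rewrite lee_fin ler_wpM2r// lerD2l lerN2 ler_wpM2r.
- apply: (le_trans (first_moment_le p02 nux rP C10 F0 mest est0 e03 XU)).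
  by rewrite lee_fin ler_wpM2r.
- apply: (le_trans (second_moment_le p02 nux rP mest est0 e03 XU)).
  rewrite lee_wpmul2r// ?lee_fin//.
  by apply: integral_ge0 => w _; rewrite lee_fin divr_ge0 ?sqr_ge0 ?incl_prob_ge0.
(* Unbiasedness of the perfect estimate: at error 0 the two first-moment bounds coincide. *)
- apply/eqP; rewrite eq_le; apply/andP; split.
    apply: (le_trans (first_moment_le p02 nux rP C10 F0 mest' est'0 z03 X'U)).
    by rewrite !mulr0 !addr0 !mul1r.
  apply: le_trans (first_moment_ge p02 nux rP C10 F0 mest' est'0 z03 X'L).
  by rewrite mulr0 subr0 mul1r.
- apply: (second_moment_ge p02 nux rP F0 mest' est'0).
  by apply: filterS X'L => w; rewrite !mulr0 subr0 addr0 !mul1r.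
Qed.
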